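(* Let $\mathcal{P}$ be an ADP problem and let $\mathcal{P}_1,\dots,\mathcal{P}_n$ ($n\ge 0$) be the SCCs of the $\mathcal{P}$-dependency graph. Then $\mathcal{P}$ is iAST if and only if $\mathcal{P}_i\cup\flat(\mathcal{P}\setminus\mathcal{P}_i)$ is iAST for every $1\le i\le n$. (That is, the processor $\mathrm{Proc}_{\mathtt{DG}}(\mathcal{P})=\{\mathcal{P}_1\cup\flat(\mathcal{P}\setminus\mathcal{P}_1),\dots,\mathcal{P}_n\cup\flat(\mathcal{P}\setminus\mathcal{P}_n)\}$ is sound and complete.)
   Context: Fix a finite signature $\Sigma=\mathcal{D}\uplus\mathcal{C}$ (defined symbols and constructors) and a set of variables $\mathcal{V}$; all left-hand sides of ADPs have root in $\mathcal{D}$. For each $f\in\mathcal{D}$ let $f^\#$ be a fresh symbol of the same arity, $\mathcal{D}^\#=\{f^\#\mid f\in\mathcal{D}\}$, $\Sigma^\#=\Sigma\uplus\mathcal{D}^\#$; elements of $\mathcal{T}(\Sigma^\#,\mathcal{V})$ are annotated terms. $\mathrm{pos}_{\Sigma'}(t)$ is the set of positions of $t$ carrying a symbol of $\Sigma'$. For $\Phi\subseteq\mathrm{pos}_{\mathcal{D}\cup\mathcal{D}^\#}(t)$, $\#_\Phi(t)$ annotates exactly the symbols at positions in $\Phi$ and removes all other annotations; $\flat(t)=\#_\emptyset(t)$ (extended to multi-distributions, ADPs and sets of ADPs termwise); $t^\#=\#_{\{\varepsilon\}}(t)$; $\flat_{\uparrow\pi}(t)$ removes all annotations strictly above position $\pi$.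 $t\trianglelefteq_\# s$ means $t=\flat(s|_\pi)$ for some $\pi\in\mathrm{pos}_{\mathcal{D}^\#}(s)$. A finite multi-distribution on $A\neq\emptyset$ is a finite multiset $\mu$ of pairs $(p:a)$, $0<p\le1$, $a\in A$, with probabilities summing to 1; $\mathrm{Supp}(\mu)$ is the multiset of its elements. An ADP is $\ell\to\{p_1:r_1,\dots,p_k:r_k\}^m$ with $\ell\in\mathcal{T}(\Sigma,\mathcal{V})\setminus\mathcal{V}$, $m\in\{\mathsf{true},\mathsf{false}\}$, $\{p_1:r_1,\dots,p_k:r_k\}$ a finite multi-distribution on $\mathcal{T}(\Sigma^\#,\mathcal{V})$, $\mathcal{V}(r_j)\subseteq\mathcal{V}(\ell)$. An ADP problem is a finite set $\mathcal{P}$ of ADPs. An annotated term $t$ is a $\mathcal{P}$-normal form if no subterm of $\flat(t)$ is an instance of a left-hand side of $\mathcal{P}$; $\mathtt{ANF}_{\mathcal{P}}$ is the set of annotated terms whose proper subterms are all $\mathcal{P}$-normal forms. $s\hookrightarrow_{\mathcal{P}}\{p_1:t_1,\dots,p_k:t_k\}$ holds if there are an ADP $\ell\to\{p_1:r_1,\dots,p_k:r_k\}^m\in\mathcal{P}$, a substitution $\sigma$ and $\pi\in\mathrm{pos}_{\mathcal{D}\cup\mathcal{D}^\#}(s)$ with $\flat(s|_\pi)=\ell\sigma\in\mathtt{ANF}_{\mathcal{P}}$ such that for all $j$: (pr) $t_j=s[r_j\sigma]_\pi$ if $\pi\in\mathrm{pos}_{\mathcal{D}^\#}(s)$, $m=\mathsf{true}$;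 (p) $t_j=\flat_{\uparrow\pi}(s[r_j\sigma]_\pi)$ if $\pi\in\mathrm{pos}_{\mathcal{D}^\#}(s)$, $m=\mathsf{false}$; (r) $t_j=s[\flat(r_j)\sigma]_\pi$ if $\pi\notin\mathrm{pos}_{\mathcal{D}^\#}(s)$, $m=\mathsf{true}$; (irr) $t_j=\flat_{\uparrow\pi}(s[\flat(r_j)\sigma]_\pi)$ if $\pi\notin\mathrm{pos}_{\mathcal{D}^\#}(s)$, $m=\mathsf{false}$. A $\mathcal{P}$-chain tree (CT) is $\mathfrak{T}=(V,E,L,V_P)$: (1) $(V,E)$ a (possibly infinite) directed tree, $V\neq\emptyset$, every node with finitely many children; (2) $L$ labels each node $v$ with $(p_v,t_v)\in(0,1]\times\mathcal{T}(\Sigma^\#,\mathcal{V})$, $p_v=1$ at the root; (3) $V_P$ is a set of inner nodes, $V_R$ the remaining inner nodes; (4) if $v\in V_P$ has children $w_1,\dots,w_k$ then $t_v\hookrightarrow_{\mathcal{P}}\{\frac{p_{w_1}}{p_v}:t_{w_1},\dots,\frac{p_{w_k}}{p_v}:t_{w_k}\}$ by case (pr) or (p); (5) likewise for $v\in V_R$ by case (r) or (irr); (6) every infinite path contains infinitely many nodes of $V_P$. $|\mathfrak{T}|_{\mathtt{Leaf}}$ is the sum of $p_v$ over all leaves $v$. $\mathcal{P}$ is iAST if $|\mathfrak{T}|_{\mathtt{Leaf}}=1$ for every $\mathcal{P}$-CT. $\mathrm{np}(\mathcal{P})$ is the ordinary TRS $\{\ell\to\flat(r_j)\mid \ell\to\{p_1:r_1,\dots,p_k:r_k\}^{\mathsf{true}}\in\mathcal{P},1\le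 j\le k\}$; $\overset{i}{\to}_{\mathrm{np}(\mathcal{P})}$ is innermost rewriting with it (annotated symbols being treated as ordinary symbols distinct from their unannotated versions). The $\mathcal{P}$-dependency graph has node set $\mathcal{P}$ and an edge from $\ell_1\to\{p_1:r_1,\dots,p_k:r_k\}^m$ to $\ell_2\to\dots$ if there are substitutions $\sigma_1,\sigma_2$ and $t\trianglelefteq_\# r_j$ for some $j$ with $t^\#\sigma_1\overset{i}{\to}{}^*_{\mathrm{np}(\mathcal{P})}\ell_2^\#\sigma_2$ and $\ell_1\sigma_1,\ell_2\sigma_2\in\mathtt{ANF}_{\mathcal{P}}$. An SCC is a maximal set $\mathcal{P}'$ of nodes such that for any (not necessarily distinct) $\alpha,\beta\in\mathcal{P}'$ there is a non-empty path from $\alpha$ to $\beta$ traversing only nodes of $\mathcal{P}'$. *)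

(* Defs.v *)
From HB Require Import structures.
From Stdlib Require Import Relation_Operators.
From mathcomp Require Import all_boot all_order all_algebra.
From mathcomp Require Import finmap multiset.
From mathcomp Require Import all_classical all_reals ereal esum.

Set Implicit Arguments.
Unset Strict Implicit.
Unset Printing Implicit Defensive.

Import Order.TTheory GRing.Theory Num.Theory.
Local Open Scope classical_set_scope.
Local Open Scope ring_scope.

(* Arguments are plain functions, so equality of terms is extensional only up
   to functional extensionality, which MathComp-Analysis assumes anyway. *)
Inductive term (F : Type) (ar : F -> nat) (V : Type) : Type :=
| Var of V
| App (f : F) of ('I_(ar f) -> term ar V).
Arguments Var {F ar V}.
Arguments App {F ar V}.

(* Classical equality and choice, needed to form multisets of terms. *)
HB.instance Definition _ F (ar : F -> nat) V := gen_eqMixin (term ar V).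
HB.instance Definition _ F (ar : F -> nat) V := gen_choiceMixin (term ar V).

Section Terms.
Context {F : Type} {ar : F -> nat} {V : Type}.
Implicit Types (s t u l r : term ar V) (p : seq nat).

Fixpoint vars t : set V :=
  match t with
  | Var x => [set x]
  | App f a => [set x | exists i, vars (a i) x]
  end.

Definition root_sym t : option F :=
  match t with Var _ => None | App f _ => Some f end.

Fixpoint subst W (sigma : V -> term ar W) t : term ar W :=
  match t with
  | Var x => sigma x
  | App f a => App f (fun i => subst sigma (a i))
  end.

(* Positions are lists of argument indices, counted from 0; [::] is the root.
   [subterm_at t p] is None when p is not a position of t. *)
Fixpoint subterm_at t p : option (term ar V) :=
  match p, t with
  | [::], _ => Some t
  | i :: q, App f a =>
      if insub i is Some j then subterm_at (a j) q else None
  | _ :: _, Var _ => None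
  end.

Definition sym_at t p : option F := obind root_sym (subterm_at t p).

Fixpoint replace t p u : term ar V :=
  match p, t with
  | [::], _ => u
  | i :: q, App f a =>
      App f (fun j => if val j == i then replace (a j) q u else a j)
  | _ :: _, Var x => Var x
  end.

Definition normal_form (L : set (term ar V)) t : Prop :=
  forall p u, subterm_at t p = Some u ->
  ~ exists l sigma, L l /\ u = subst sigma l.

Definition innermost_step (RR : set (term ar V * term ar V)) s t : Prop :=
  exists l r sigma p,
    [/\ RR (l, r),
        subterm_at s p = Some (subst sigma l),
        forall q u, q != [::] -> subterm_at (subst sigma l) q = Some u ->
          normal_form (fst @` RR) u
      & t = replace s p (subst sigma r)].

End Terms.

Record signature := Signature {
  defs : finType;
  ctors : finType;
  arity : defs + ctors -> nat
}.

Definition sym (Sg : signature) := (defs Sg + ctors Sg)%type.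

(* [inl f] is the symbol f itself, [inr f] is f^#. *)
Definition asym (Sg : signature) := (sym Sg + defs Sg)%type.

Definition flat_sym (Sg : signature) (f : asym Sg) : sym Sg :=
  match f with inl g => g | inr d => inl d end.

Definition aarity (Sg : signature) (f : asym Sg) : nat := arity (flat_sym f).

Notation uterm Sg V := (term (@arity Sg) V).
Notation aterm Sg V := (term (@aarity Sg) V).

Section Annotations.
Context {Sg : signature} {V : Type}.

Fixpoint flat (t : aterm Sg V) : uterm Sg V :=
  match t with
  | Var x => Var x
  | App f a => App (flat_sym f) (fun i => flat (a i))
  end.

(* The inclusion of T(Sigma,V) into T(Sigma^#,V); thus flattening, as an
   operation on annotated terms, is [emb \o flat]. *)
Fixpoint emb (t : uterm Sg V) : aterm Sg V :=
  match t with
  | Var x => Var x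
  | App f a => App (inl f : asym Sg) (fun i => emb (a i))
  end.

(* t^# *)
Definition sharp (t : uterm Sg V) : aterm Sg V :=
  match t with
  | Var x => Var x
  | App (inl d) a => App (inr d : asym Sg) (fun i => emb (a i))
  | App (inr c) a => App (inl (inr c) : asym Sg) (fun i => emb (a i))
  end.

Fixpoint flat_above (p : seq nat) (t : aterm Sg V) : aterm Sg V :=
  match p, t with
  | i :: q, App f a =>
      App (inl (flat_sym f) : asym Sg)
          (fun j => if val j == i then flat_above q (a j) else a j)
  | _, _ => t
  end.

Definition pos_annot (t : aterm Sg V) : set (seq nat) :=
  [set p | exists d : defs Sg, sym_at t p = Some (inr d)].

Definition pos_def (t : aterm Sg V) : set (seq nat) :=
  [set p | exists d : defs Sg,
     sym_at t p = Some (inl (inl d)) \/ sym_at t p = Some (inr d)].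

Definition annot_sub (t : uterm Sg V) (s : aterm Sg V) : Prop :=
  exists p u, [/\ pos_annot s p, subterm_at s p = Some u & t = flat u].

Definition asubst (sigma : V -> uterm Sg V) (t : aterm Sg V) : aterm Sg V :=
  subst (emb \o sigma) t.

End Annotations.

Definition mset_map (A B : choiceType) (f : A -> B) (mu : {mset A}%mset) :
  {mset B}%mset := seq_mset [seq f x | x <- mu].

Definition multi_distribution (R : realType) (A : choiceType)
    (mu : {mset R * A}%mset) : Prop :=
  (forall x, x \in mu -> 0 < x.1 <= 1) /\ \sum_(x <- mu) x.1 = 1.

(* Raw triples; the conditions on an ADP are in [is_adp]. *)
Record adp (R : realType) (Sg : signature) (V : Type) := ADP {
  lhs : uterm Sg V;
  rhs : {mset R * aterm Sg V}%mset;
  flag : bool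
}.

Section ADPProblems.
Context {R : realType} {Sg : signature} {V : Type}.
Implicit Types (al be : adp R Sg V) (P Q : set (adp R Sg V)).
Implicit Types (s t r : aterm Sg V) (sigma : V -> uterm Sg V).

Definition is_adp al : Prop :=
  [/\ exists d : defs Sg, root_sym (lhs al) = Some (inl d),
      multi_distribution (rhs al)
    & forall x, x \in rhs al -> vars x.2 `<=` vars (lhs al)].

Definition adp_problem P : Prop := finite_set P /\ P `<=` [set al | is_adp al].

Definition flat_adp al : adp R Sg V :=
  ADP (lhs al) (mset_map (fun x => (x.1, emb (flat x.2))) (rhs al)) (flag al).

Definition adp_nf P t : Prop := normal_form (@lhs R Sg V @` P) (flat t).

Definition ANF P : set (aterm Sg V) :=
  [set t | forall p u, p != [::] -> subterm_at t p = Some u -> adp_nf P u].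

Definition redex P s al sigma (p : seq nat) : Prop :=
  [/\ P al, pos_def s p,
      exists2 u, subterm_at s p = Some u & flat u = subst sigma (lhs al)
    & ANF P (emb (subst sigma (lhs al)))].

Variant step_case := case_pr | case_p | case_r | case_irr.

Inductive adp_step P s : step_case -> {mset R * aterm Sg V}%mset -> Prop :=
| step_pr al sigma p : redex P s al sigma p -> pos_annot s p -> flag al ->
    adp_step P s case_pr
      (mset_map (fun x => (x.1, replace s p (asubst sigma x.2))) (rhs al))
| step_p al sigma p : redex P s al sigma p -> pos_annot s p -> ~~ flag al ->
    adp_step P s case_p
      (mset_map (fun x =>
         (x.1, flat_above p (replace s p (asubst sigma x.2)))) (rhs al))
| step_r al sigma p : redex P s al sigma p -> ~ pos_annot s p -> flag al ->
    adp_step P s case_r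
      (mset_map (fun x =>
         (x.1, replace s p (asubst sigma (emb (flat x.2))))) (rhs al))
| step_irr al sigma p : redex P s al sigma p -> ~ pos_annot s p -> ~~ flag al ->
    adp_step P s case_irr
      (mset_map (fun x =>
         (x.1, flat_above p (replace s p (asubst sigma (emb (flat x.2))))))
         (rhs al)).

End ADPProblems.

(* The node set is the whole type N. *)
Record labelled_tree (R : realType) (Sg : signature) (V : Type)
    (N : choiceType) := LabelledTree {
  edge : N -> N -> Prop;
  prob : N -> R;
  label : N -> aterm Sg V;
  nodesP : set N
}.

Definition directed_tree (N : Type) (E : N -> N -> Prop) (r : N) : Prop :=
  [/\ forall v, ~ E v r,
      forall u v w, E u w -> E v w -> u = v
    & forall v, clos_refl_trans N E r v].

Section ChainTrees.
Context {R : realType} {Sg : signature} {V : Type} {N : choiceType}.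
Implicit Types (P : set (adp R Sg V)) (T : labelled_tree R Sg V N) (v : N).

Definition children T v : set N := [set w | edge T v w].

Definition leaf T : set N := [set v | children T v = set0].

Definition child_distr T v : {mset R * aterm Sg V}%mset :=
  seq_mset [seq (prob T w / prob T v, label T w) | w <- fset_set (children T v)].

Definition chain_tree P T : Prop :=
  (exists2 r, directed_tree (edge T) r & prob T r = 1) /\
  [/\ forall v, finite_set (children T v),
      forall v, 0 < prob T v <= 1,
      nodesP T `<=` ~` leaf T,
      (forall v, nodesP T v ->
         adp_step P (label T v) case_pr (child_distr T v) \/
         adp_step P (label T v) case_p (child_distr T v)) /\
      (forall v, ~ leaf T v -> ~ nodesP T v ->
         adp_step P (label T v) case_r (child_distr T v) \/
         adp_step P (label T v) case_irr (child_distr T v))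
    & forall w : nat -> N, (forall n, edge T (w n) (w n.+1)) ->
        forall n, exists2 m, (n <= m)%N & nodesP T (w m)].

Definition leaf_prob T : \bar R := \esum_(v in leaf T) (prob T v)%:E.

End ChainTrees.

Definition iAST (R : realType) (Sg : signature) (V : Type)
    (P : set (adp R Sg V)) : Prop :=
  forall (N : choiceType) (T : labelled_tree R Sg V N),
    chain_tree P T -> leaf_prob T = 1%E.

Section DependencyGraph.
Context {R : realType} {Sg : signature} {V : Type}.
Implicit Types (al be : adp R Sg V) (P Q : set (adp R Sg V)).

(* The rules are embedded into annotated terms, because rewriting takes place
   on terms with an annotated root. *)
Definition np P : set (aterm Sg V * aterm Sg V) :=
  [set lr | exists al x, [/\ P al, flag al, x \in rhs al &
              lr = (emb (lhs al), emb (flat x.2))]].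

Definition dg_edge P al be : Prop :=
  P al /\ P be /\
  exists (sigma1 sigma2 : V -> uterm Sg V) (x : R * aterm Sg V) (t : uterm Sg V),
    [/\ x \in rhs al, annot_sub t x.2,
        clos_refl_trans _ (innermost_step (np P))
          (asubst sigma1 (sharp t)) (asubst sigma2 (sharp (lhs be))),
        ANF P (emb (subst sigma1 (lhs al)))
      & ANF P (emb (subst sigma2 (lhs be)))].

Definition strongly_connected P Q : Prop :=
  forall al be, Q al -> Q be ->
    clos_trans _ (fun a b => [/\ Q a, Q b & dg_edge P a b]) al be.

(* Non-emptiness is explicit: otherwise the empty set would be the only SCC of
   an acyclic graph. *)
Definition SCC P Q : Prop :=
  [/\ Q !=set0, Q `<=` P, strongly_connected P Q
    & forall Q', Q `<=` Q' -> Q' `<=` P -> strongly_connected P Q' -> Q' = Q].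

End DependencyGraph.

(* Main.v *)
(** Soundness. Let [T] be a chain tree of [P]. Along an infinite path of [T],
    every annotation that is consumed late enough was created by an earlier
    annotated step, and the two ADPs are joined by an edge of the dependency
    graph. Choosing among the ADPs used infinitely often one that is maximal
    for reachability, the path from some node [u] on uses infinitely often
    annotations that are created and consumed inside a single SCC [Q]: if the
    labels are restarted at [u] and the ADPs outside [Q] are flattened, the
    path still meets infinitely many annotated redexes. There are countably
    many pairs [(u, Q)], so it is enough that for each of them such paths form
    a null set. Otherwise, pruning the tree below [u] at suitable depths would
    give a chain tree of the processed problem with leaf probability below 1.
    Null sets are handled without a measure on paths: a set of paths is null
    if it is covered by sets of nodes of arbitrarily small probability, and by
    König's lemma the set of all infinite paths is null only if the leaves have
    total probability 1.

    Completeness. Restoring the annotations erased from a processed problem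
    turns each of its chain trees into a chain tree of [P] of the same shape. *)

From HB Require Import structures.
Require Import Defs.
From Stdlib Require Import Relation_Operators Operators_Properties.
From mathcomp Require Import all_boot all_order all_algebra.
From mathcomp Require Import finmap multiset.
From mathcomp Require Import all_classical all_reals ereal esum.
From mathcomp Require Import zify ring lra.

Set Implicit Arguments.
Unset Strict Implicit.
Unset Printing Implicit Defensive.

Import Order.TTheory GRing.Theory Num.Theory.
Local Open Scope classical_set_scope.
Local Open Scope ring_scope.

(** * Terms, positions and annotations *)

Section Positions.
Context {F : Type} {ar : F -> nat} {V : Type}.
Implicit Types (s t u : term ar V) (p q : seq nat).

Lemma subterm_at_cat t p q :
  subterm_at t (p ++ q) = obind (subterm_at ^~ q) (subterm_at t p).
Proof. by elim: p t => [|i p IH] [x|f a] //=; case: insub => //=. Qed.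

Lemma subterm_at_nil t : subterm_at t [::] = Some t.
Proof. by case: t. Qed.

Lemma subterm_at_replace t p q u : subterm_at t p <> None ->
  subterm_at (replace t p u) (p ++ q) = subterm_at u q.
Proof.
elim: p t => [|i p IH] [x|f a] //=.
by case: insubP => //= j _ <-; rewrite eqxx; exact: IH.
Qed.

Lemma subterm_at_replace_above t p q u :
  subterm_at (replace t (p ++ q) u) p =
  omap (fun a => replace a q u) (subterm_at t p).
Proof.
elim: p t => [|i p IH] [x|f a] //=; first by rewrite subterm_at_nil.
  by rewrite subterm_at_nil.
by case: insubP => //= j _ ji; rewrite ji eqxx.
Qed.

Lemma subterm_at_replace_parallel t p q u : ~~ prefix p q -> ~~ prefix q p ->
  subterm_at (replace t p u) q = subterm_at t q.
Proof.
elim: p q t => [|i p IH] [|k q] [x|f a] //=.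
case: insubP => //= j _ ->; rewrite [i == k]eq_sym.
by case: eqP => //= _; exact: IH.
Qed.

Fixpoint positions t : seq (seq nat) :=
  match t with
  | Var _ => [:: [::]]
  | App f a =>
      [::] :: flatten [seq [seq val i :: p | p <- positions (a i)] |
                        i <- enum 'I_(ar f)]
  end.

(** Finiteness of the set of positions later bounds how many annotations of a single label can be
    consumed. *)
Lemma mem_positions t p : subterm_at t p <> None -> p \in positions t.
Proof.
elim: t p => [x|f a IH] [|i p] //=.
case: insubP => //= j _ <- /IH pin; rewrite inE; apply/flattenP.
exists [seq val j :: p0 | p0 <- positions (a j)].
  by apply/mapP; exists j; rewrite ?mem_enum.
by apply/mapP; exists p.
Qed.

End Positions.

(** * Flattening, annotations and their behaviour under replacement *)

Section Annotated.
Context {Sg : signature} {V : Type}.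
Implicit Types (s t u x : aterm Sg V) (p q : seq nat) (e : uterm Sg V).
Implicit Types (sigma : V -> uterm Sg V).

Lemma emb_subst sigma e : emb (subst sigma e) = subst (emb \o sigma) (emb e).
Proof. by elim: e => [x|f a IH] //=; congr App; apply/funext => i; exact: IH. Qed.

Lemma flat_emb e : flat (emb e) = e.
Proof. by elim: e => [x|f a IH] //=; congr App; apply/funext => i; exact: IH. Qed.

Lemma flat_subst (tau : V -> aterm Sg V) t :
  flat (subst tau t) = subst (@flat Sg V \o tau) (flat t).
Proof. by elim: t => [x|f a IH] //=; congr App; apply/funext => i; exact: IH. Qed.

Lemma flat_asubst sigma t : flat (asubst sigma t) = subst sigma (flat t).
Proof.
rewrite /asubst flat_subst; congr subst.
by apply/funext => x /=; rewrite flat_emb.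
Qed.

Lemma subterm_at_flat t p :
  subterm_at (flat t) p = omap (@flat Sg V) (subterm_at t p).
Proof. by elim: p t => [|i p IH] [x|f a] //=; case: insub => //=. Qed.

Lemma subterm_at_emb e p :
  subterm_at (emb e) p = omap (@emb Sg V) (subterm_at e p).
Proof. by elim: p e => [|i p IH] [x|f a] //=; case: insub => //=. Qed.

Lemma flat_replace t p u : flat (replace t p u) = replace (flat t) p (flat u).
Proof.
elim: p t => [|i p IH] [x|f a] //=; congr App; apply/funext => j.
by case: eqP => // _; exact: IH.
Qed.

Lemma emb_replace e p e' : emb (replace e p e') = replace (emb e) p (emb e').
Proof.
elim: p e => [|i p IH] [x|f a] //=; congr App; apply/funext => j.
by case: eqP => // _; exact: IH.
Qed.

Lemma flat_flat_above p t : flat (flat_above p t) = flat t.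
Proof.
elim: p t => [|i p IH] [x|f a] //=; congr App; apply/funext => j.
by case: eqP => // _; exact: IH.
Qed.

Definition ann t p : bool := if sym_at t p is Some (inr _) then true else false.

Lemma pos_annotP t p : reflect (pos_annot t p) (ann t p).
Proof.
rewrite /pos_annot /ann; case E: (sym_at t p) => [[g|d]|] /=.
- by constructor => -[d]; rewrite E.
- by constructor; exists d; rewrite E.
- by constructor => -[d]; rewrite E.
Qed.

Lemma ann_cons (f : asym Sg) (a : 'I_(aarity f) -> aterm Sg V) i p :
  ann (App f a) (i :: p) = if insub i is Some j then ann (a j) p else false.
Proof. by rewrite /ann /sym_at /=; case: insub. Qed.

Lemma ann_var (x : V) p : ann (Var x : aterm Sg V) p = false.
Proof. by case: p. Qed.

Lemma ann_emb e p : ann (emb e) p = false.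
Proof.
elim: p e => [|i p IH] [x|f a] //=.
by rewrite ann_cons; case: insub => //= j; exact: IH.
Qed.

Lemma ann_asubst sigma t p : ann (asubst sigma t) p = ann t p.
Proof.
elim: t p => [x|f a IH] p; first by rewrite /= ann_emb ann_var.
by case: p => [//|i p]; rewrite /= !ann_cons; case: insub => // j; exact: IH.
Qed.

Lemma ann_replace t p q u : subterm_at t p <> None ->
  ann (replace t p u) q =
  if prefix p q then ann u (drop (size p) q) else ann t q.
Proof.
elim: p q t => [|i p IH] q [x|f a] //=; rewrite ?prefix0s ?drop0 //.
case: insubP => //= j _ ji pP; case: q => [//|k q] /=.
rewrite !ann_cons; case: insubP => [k' _ k'k|]; last first.
  rewrite -ji; case: eqP => //= jk; rewrite -jk.
  by rewrite ltn_ord.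
rewrite -k'k -ji; case: (eqVneq j k') => [<-|jk].
  by rewrite !eqxx; exact: IH.
have -> : (val k' == val j) = false by apply/negbTE; rewrite eq_sym.
by have -> : (val j == val k') = false by apply/negbTE.
Qed.

Lemma ann_flat_above t p q :
  ann (flat_above p t) q = ann t q && ~~ (prefix q p && (q != p)).
Proof.
elim: p q t => [|i p IH] q t.
  have -> : flat_above [::] t = t by case: t.
  by rewrite prefixs0; case: eqP; rewrite ?andbT.
case: t => [x|f a] /=; first by rewrite ann_var.
case: q => [|k q]; first by rewrite /= andbF.
rewrite !ann_cons /=; case: insubP => [j _ <-|//].
rewrite eqseq_cons; case: eqP => [_|_] /=; first exact: IH.
by rewrite andbT.
Qed.

(* The four cases of the rewrite relation at once: an unannotated redex
   flattens the right-hand side, a false flag erases the annotations above. *)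
Definition next s (fl : bool) sigma p x : aterm Sg V :=
  let t := replace s p (asubst sigma (if ann s p then x else emb (flat x))) in
  if fl then t else flat_above p t.

Lemma flat_next s fl sigma p x :
  flat (next s fl sigma p x) = replace (flat s) p (subst sigma (flat x)).
Proof.
rewrite /next; case: fl; rewrite ?flat_flat_above flat_replace flat_asubst;
  by case: (ann s p); rewrite ?flat_emb.
Qed.

(** Substitutions contribute no annotations, so at or below the redex only those of the right-hand
    side appear. The hypothesis is on [flat s] because redexes are located in flattened labels. *)
Lemma ann_next s fl sigma p x q : subterm_at (flat s) p <> None ->
  ann (next s fl sigma p x) q =
  if prefix p q then ann s p && ann x (drop (size p) q)
  else ann s q && (fl || ~~ prefix q p).
Proof.
move=> sp; have {}sp : subterm_at s p <> None.
  by move: sp; rewrite subterm_at_flat; case: subterm_at.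
have E : forall r, ann (asubst sigma (if ann s p then x else emb (flat x))) r =
   ann s p && ann x r.
  by move=> r; rewrite ann_asubst; case: (ann s p); rewrite ?ann_emb.
rewrite /next; case: fl.
  by rewrite ann_replace // E /= andbT.
rewrite ann_flat_above ann_replace // E /=; case: ifP => pq; last first.
  by case qp: (prefix q p) => //=; case: eqP qp pq => //= ->; rewrite prefix_refl.
rewrite [X in _ && ~~ X](_ : _ = false) ?andbT //.
(* Since [q] extends [p], it cannot lie strictly above [p]: nothing at or below the redex is
   erased. *)
apply/negbTE/negP => /andP[/prefixP[r pr]] /eqP; apply.
case/prefixP: pq pr => r' -> /eqP; rewrite -catA -{1}[p]cats0 eqseq_cat //.
by rewrite eqxx /= eq_sym; case: r' => //=; rewrite cats0.
Qed.

End Annotated.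

(** * Rewrite steps *)

(** Needed because [h] may identify several elements: an equality of image multisets does not say
    which element of a right-hand side produced which child. Matched elements are removed one at a
    time; [b0] is a default outside [s]. *)
Lemma perm_map_match (A B C : eqType) (b0 : B) (g : A -> C) (h : B -> C)
    (s : seq A) (X : seq B) :
  uniq s -> perm_eq (map g s) (map h X) ->
  exists2 f : A -> B, perm_eq (map f s) X & {in s, forall w, g w = h (f w)}.
Proof.
elim: s X => [|c s IH] X /=.
  by move=> _ /perm_size; case: X => // _; exists (fun=> b0).
move=> /andP[cs us] gX.
have /mapP[x xX gc] : g c \in map h X by rewrite -(perm_mem gX) mem_head.
have Xx := perm_to_rem xX.
have {}gX : perm_eq (map g s) (map h (rem x X)).
  by rewrite -(perm_cons (g c)) {2}gc; apply: perm_trans gX (perm_map h Xx).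
have [f fX gf] := IH _ us gX.
have fE w : w \in s -> (if w == c then x else f w) = f w.
  by case: eqP => // -> cs'; rewrite cs' in cs.
exists (fun w => if w == c then x else f w).
  rewrite eqxx perm_sym (perm_trans Xx) // perm_cons perm_sym.
  by rewrite (_ : map _ s = map f s) //; apply/eq_in_map.
by move=> w; rewrite inE; case: eqP => [-> _|_ /= ws] //; exact: gf.
Qed.

Section Steps.
Context {R : realType} {Sg : signature} {V : Type}.
Implicit Types (al be : adp R Sg V) (P Q : set (adp R Sg V)).
Implicit Types (s t : aterm Sg V) (sigma : V -> uterm Sg V).

Definition def_root al := exists d : defs Sg, root_sym (lhs al) = Some (inl d).

(** A defined root of the left-hand side makes the condition on the symbol at [p] automatic. Being a
    redex thus depends on [flat s] only, so moves carry over between trees that differ in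
    annotations alone. *)
Lemma redexE P s al sigma p : P al -> def_root al ->
  redex P s al sigma p <->
  (subterm_at (flat s) p = Some (subst sigma (lhs al)) /\
   ANF P (emb (subst sigma (lhs al)))).
Proof.
move=> Pal [d ld]; rewrite subterm_at_flat; split.
  by case=> _ _ [u -> <-] ?.
case su: (subterm_at s p) => [u|] /= [//]; case=> fu anf.
split => //; last by exists u.
rewrite /pos_def /sym_at /= su /=.
move: ld fu; case: (lhs al) => //= f a [fd] /(congr1 root_sym) /= {su}; rewrite fd.
case: u => //= g b [].
by case: g b => [g|d'] b /= E; exists d; [left; rewrite E|right; case: E => ->].
Qed.

Definition next_distr s al sigma p : {mset R * aterm Sg V}%mset :=
  mset_map (fun x => (x.1, next s (flag al) sigma p x.2)) (rhs al).

Lemma step_inv P s c mu : adp_step P s c mu -> exists al sigma p,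
  [/\ redex P s al sigma p,
      ann s p = (if c is case_pr then true else if c is case_p then true else false)
    & mu = next_distr s al sigma p].
Proof.
case=> al sigma p red /pos_annotP sp fl; exists al, sigma, p; split=> //;
  rewrite ?(negbTE sp) //; rewrite /next_distr /next.
- by rewrite sp fl.
- by rewrite sp (negbTE fl).
- by rewrite (negbTE sp) fl.
- by rewrite (negbTE sp) (negbTE fl).
Qed.

Lemma step_next P s al sigma p : redex P s al sigma p ->
  let mu := next_distr s al sigma p in
  if ann s p then adp_step P s case_pr mu \/ adp_step P s case_p mu
  else adp_step P s case_r mu \/ adp_step P s case_irr mu.
Proof.
move=> red; rewrite /next_distr /next /=.
case: (boolP (ann s p)) => sp; case: (boolP (flag al)) => fl.
- by left; apply: step_pr => //; apply/pos_annotP.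
- by right; apply: step_p => //; apply/pos_annotP.
- by left; apply: step_r => //; apply/pos_annotP.
- by right; apply: step_irr => //; apply/pos_annotP.
Qed.

Context {N : choiceType}.
Implicit Types (T : labelled_tree R Sg V N) (v w : N).

(* [mv_pick] matches each child with the element of the right-hand side that
   produced its label. *)
Record move := Move {
  mv_adp : adp R Sg V;
  mv_sub : V -> uterm Sg V;
  mv_pos : seq nat;
  mv_pick : N -> R * aterm Sg V
}.

Definition succ_label (m : move) s w : aterm Sg V :=
  next s (flag (mv_adp m)) (mv_sub m) (mv_pos m) (mv_pick m w).2.

Definition good_move P T v (m : move) : Prop :=
  [/\ redex P (label T v) (mv_adp m) (mv_sub m) (mv_pos m),
      perm_eq [seq mv_pick m w | w <- fset_set (children T v)] (rhs (mv_adp m)),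
      forall w, edge T v w -> prob T w = prob T v * (mv_pick m w).1
    & forall w, edge T v w -> label T w = succ_label m (label T v) w].

(** The step conditions of a chain tree, separated from the one on infinite paths, which pruning has
    to restore. *)
Definition locally_chain P T : Prop :=
  (forall v, nodesP T v ->
     adp_step P (label T v) case_pr (child_distr T v) \/
     adp_step P (label T v) case_p (child_distr T v)) /\
  (forall v, ~ leaf T v -> ~ nodesP T v ->
     adp_step P (label T v) case_r (child_distr T v) \/
     adp_step P (label T v) case_irr (child_distr T v)).

Lemma step_good_move P T v c : finite_set (children T v) -> 0 < prob T v ->
  adp_step P (label T v) c (child_distr T v) ->
  exists2 m, good_move P T v m & ann (label T v) (mv_pos m) =
    (if c is case_pr then true else if c is case_p then true else false).
Proof.
move=> fin pv /step_inv[al [sigma [p [red annE /esym /eq_seq_msetP]]]].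
rewrite perm_sym.
(* The pair [(0, label T v)] is a default for nodes that are not children of [v]. *)
move/(perm_map_match (0, label T v) (fset_uniq _)) => [f fperm fE].
exists (Move al sigma p f) => //; split => // w vw.
  have /fE[<- _] : w \in fset_set (children T v) by rewrite in_fset_set// inE.
  by rewrite mulrCA divff ?mulr1 ?gt_eqF.
have /fE[_ ->] : w \in fset_set (children T v) by rewrite in_fset_set// inE.
by [].
Qed.

Lemma locally_chain_move P T : (forall v, finite_set (children T v)) ->
  (forall v, 0 < prob T v) -> locally_chain P T ->
  forall v, ~ leaf T v ->
  exists2 m, good_move P T v m & nodesP T v <-> ann (label T v) (mv_pos m).
Proof.
move=> fin pos [stepP stepR] v vl.
have [vP|vP] := pselect (nodesP T v).
  by case: (stepP v vP) => /(step_good_move (fin v) (pos v))[m gm E];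
     exists m => //; rewrite E; split.
by case: (stepR v vl vP) => /(step_good_move (fin v) (pos v))[m gm E];
   exists m => //; rewrite E; split.
Qed.

Lemma good_move_step P T v m : finite_set (children T v) -> 0 < prob T v ->
  good_move P T v m ->
  if ann (label T v) (mv_pos m)
  then adp_step P (label T v) case_pr (child_distr T v) \/
       adp_step P (label T v) case_p (child_distr T v)
  else adp_step P (label T v) case_r (child_distr T v) \/
       adp_step P (label T v) case_irr (child_distr T v).
Proof.
move=> fin pv [red perm pE lE].
suff -> : child_distr T v =
    next_distr (label T v) (mv_adp m) (mv_sub m) (mv_pos m).
  exact: step_next.
apply/eq_seq_msetP; rewrite -(permPr (perm_map _ perm)) -map_comp.
set l1 := map _ _; set l2 := map _ _; suff -> : l1 = l2 by [].
apply/eq_in_map => w; rewrite in_fset_set// inE => vw /=.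
by rewrite pE// lE// mulrAC divff ?mul1r ?gt_eqF.
Qed.

Lemma good_move_flow P T v m : multi_distribution (rhs (mv_adp m)) ->
  finite_set (children T v) -> good_move P T v m ->
  \sum_(w <- fset_set (children T v)) prob T w = prob T v.
Proof.
move=> [_ sum1] fin [_ perm pE _].
rewrite (eq_big_seq (fun w => prob T v * (mv_pick m w).1)); last first.
  by move=> w; rewrite in_fset_set// inE => /pE.
rewrite -mulr_sumr -(big_map (mv_pick m) xpredT fst) (perm_big _ perm).
by rewrite sum1 mulr1.
Qed.

End Steps.

(** * Trees with a probability flow *)

Lemma uniq_flatten_map (A B : eqType) (f : A -> seq B) (s : seq A) :
  uniq s -> {in s, forall a, uniq (f a)} ->
  {in s &, forall a b, forall x, x \in f a -> x \in f b -> a = b} ->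
  uniq (flatten (map f s)).
Proof.
elim: s => [//|a s IH] /= /andP[as_ us] uf disj.
rewrite cat_uniq uf ?mem_head//= IH //; last 2 first.
- by move=> b bs; apply: uf; rewrite inE bs orbT.
- by move=> b c bs cs; apply: disj; rewrite inE ?bs ?cs orbT.
rewrite andbT; apply/hasPn => x /flattenP[_ /mapP[b bs ->] xb].
apply/negP => xa; move: as_; rewrite (disj a b _ _ x) ?mem_head ?bs//.
by rewrite inE bs orbT.
Qed.

Lemma ler_sum_subset (R : numDomainType) (A : eqType) (f : A -> R)
    (s1 s2 : seq A) :
  uniq s1 -> {subset s1 <= s2} -> (forall a, 0 <= f a) ->
  \sum_(a <- s1) f a <= \sum_(a <- s2) f a.
Proof.
move=> + + f0; elim: s1 s2 => [|a s1 IH] s2 /=.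
  by move=> _ _; rewrite big_nil; apply: sumr_ge0.
move=> /andP[as1 us1] sub; have as2 : a \in s2 by rewrite sub ?mem_head.
rewrite big_cons (perm_big _ (perm_to_rem as2)) big_cons lerD2l IH// => b bs1.
have := sub b; rewrite inE bs1 orbT => /(_ isT).
rewrite (perm_mem (perm_to_rem as2)) inE => /orP[/eqP ba|//].
by rewrite -ba bs1 in as1.
Qed.

Lemma ler_sum_in (R : numDomainType) (A : eqType) (f g : A -> R) (s : seq A) :
  {in s, forall a, f a <= g a} -> \sum_(a <- s) f a <= \sum_(a <- s) g a.
Proof. by move=> fg; rewrite big_seq [leRHS]big_seq; exact: ler_sum. Qed.

(** What remains of a chain tree when labels are forgotten: a unit flow from the root, conserved at
    inner nodes. *)
Record flow_tree (R : realType) (N : choiceType) (E : N -> N -> Prop) (r : N)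
    (p : N -> R) : Prop := FlowTree {
  ft_tree : directed_tree E r;
  ft_fin : forall v, finite_set [set w | E v w];
  ft_root : p r = 1;
  ft_pos : forall v, 0 < p v;
  ft_flow : forall v, [set w | E v w] !=set0 ->
    \sum_(w <- fset_set [set w | E v w]) p w = p v
}.

(** * Rooted trees: depth, ancestors, recursion and König's lemma *)

Section Rooted.
Context {N : choiceType}.
Variables (E : N -> N -> Prop) (r : N).

Fixpoint reach n v : Prop :=
  if n is n'.+1 then exists2 u, reach n' u & E u v else v = r.

Definition depth v : nat := xget 0%N [set n | reach n v].
Definition par v : N := xget v [set u | E u v].

(** Recursion from the root downwards. The tree is only an edge relation, so the recursion runs on
    the depth and climbs through parents. *)
Fixpoint treefun_at (X : Type) (x0 : X) (g : N -> N -> X -> X) n v : X :=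
  if n is n'.+1 then g (par v) v (treefun_at x0 g n' (par v)) else x0.

Definition treefun (X : Type) (x0 : X) (g : N -> N -> X -> X) v : X :=
  treefun_at x0 g (depth v) v.

(* For [n] at most the depth of [v], the ancestor of [v] at depth [n];
   otherwise [v] itself. *)
Definition anc : N -> nat -> N :=
  treefun (fun=> r) (fun v w a n => if (n <= depth v)%N then a n else w).

Definition tip v := forall w, ~ E v w.

Definition heredit (G : N -> Prop) := forall v w, E v w -> G v -> G w.

Hypothesis tree : directed_tree E r.

Lemma tree_induction (Q : N -> Prop) : Q r ->
  (forall v w, E v w -> Q v -> Q w) -> forall v, Q v.
Proof.
move=> Qr Qs v; have [_ _ /(_ v)] := tree.
by move/clos_rt_rtn1_iff; elim => // y z yz _; exact: Qs.
Qed.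

Lemma reach_ex v : exists n, reach n v.
Proof.
move: v; apply: tree_induction; first by exists 0%N.
by move=> v w vw [n nv]; exists n.+1; exists v.
Qed.

Lemma reach_uniq n m v : reach n v -> reach m v -> n = m.
Proof.
have [nor up _] := tree.
elim: n m v => [|n IH] [|m] v //=.
- by move=> -> [u _ /nor].
- by move=> [u _ uv] vr; move: uv; rewrite vr => /nor.
- by move=> [u nu uv] [u' mu' u'v]; rewrite (up _ _ _ u'v uv) in mu';
     rewrite (IH _ _ nu mu').
Qed.

Lemma reach_depth v : reach (depth v) v.
Proof. by rewrite /depth; have [n nv] := reach_ex v; case: xgetP => [m _|/(_ n)]. Qed.

Lemma depth_root : depth r = 0%N.
Proof. exact: (reach_uniq (reach_depth r)). Qed.

Lemma depth_edge v w : E v w -> depth w = (depth v).+1.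
Proof.
move=> vw; apply: (reach_uniq (reach_depth w)) => /=; exists v => //.
exact: reach_depth.
Qed.

Lemma depth0 v : depth v = 0%N -> v = r.
Proof. by move=> d; have := reach_depth v; rewrite d. Qed.

Lemma depthS v n : depth v = n.+1 -> exists2 u, E u v & depth u = n.
Proof.
move=> d; have := reach_depth v; rewrite d => -[u nu uv]; exists u => //.
exact: reach_uniq (reach_depth u) nu.
Qed.

Lemma par_edge v w : E v w -> par w = v.
Proof.
have [_ up _] := tree; move=> vw; rewrite /par.
by case: xgetP => [u _ /= uw|/(_ v)//]; exact: up uw vw.
Qed.

Lemma treefun_root X (x0 : X) g : treefun x0 g r = x0.
Proof. by rewrite /treefun depth_root. Qed.

Lemma treefun_edge X (x0 : X) g v w : E v w ->
  treefun x0 g w = g v w (treefun x0 g v).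
Proof. by move=> vw; rewrite /treefun (depth_edge vw) /= (par_edge vw). Qed.

Lemma anc_edge v w n : E v w ->
  anc w n = if (n <= depth v)%N then anc v n else w.
Proof. by move=> vw; rewrite /anc (treefun_edge _ _ vw). Qed.

Lemma anc_id v n : (depth v <= n)%N -> anc v n = v.
Proof.
move: v; apply: tree_induction => [|v w vw _]; first by rewrite /anc treefun_root.
by rewrite (depth_edge vw) (anc_edge _ vw) ltnNge => /negbTE ->.
Qed.

Lemma depth_anc v n : (n <= depth v)%N -> depth (anc v n) = n.
Proof.
move: v; apply: tree_induction => [|v w vw IH].
  by rewrite depth_root leqn0 => /eqP ->; rewrite anc_id ?depth_root.
rewrite (anc_edge _ vw); case: ifP => [/IH//|]; rewrite (depth_edge vw).
by move=> nv nv'; apply/eqP; rewrite eqn_leq nv' ltnNge nv.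
Qed.

Lemma edge_anc v n : (n < depth v)%N -> E (anc v n) (anc v n.+1).
Proof.
move: v; apply: tree_induction => [|v w vw IH]; first by rewrite depth_root.
rewrite (depth_edge vw) ltnS => nv; rewrite !(anc_edge _ vw) nv.
case: ifP => [/IH//|]; rewrite ltnNge => /negbFE vn.
by rewrite anc_id.
Qed.

Lemma anc_anc v n m : (m <= n)%N -> anc (anc v n) m = anc v m.
Proof.
move=> mn; move: v; apply: tree_induction => [|v w vw IH].
  by rewrite [anc r n]anc_id ?depth_root.
rewrite (anc_edge n vw); case: ifP => nv.
  by rewrite (anc_edge m vw) (leq_trans mn nv) IH.
by [].
Qed.

Lemma heredit_anc G v n : heredit G -> G (anc v n) -> G v.
Proof.
move=> hG; move: v; apply: tree_induction => [|v w vw IH].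
  by rewrite anc_id// depth_root.
by rewrite (anc_edge _ vw); case: ifP => // _ /IH; exact: hG.
Qed.

Lemma not_tip v : ~ tip v -> exists w, E v w.
Proof. by move=> /existsNP[w /contrapT]; exists w. Qed.

Lemma path_depth (w : nat -> N) : (forall n, E (w n) (w n.+1)) ->
  forall n, depth (w n) = (depth (w 0%N) + n)%N.
Proof.
by move=> wE; elim=> [|n IH]; rewrite ?addn0// (depth_edge (wE n)) IH addnS.
Qed.

(** Call a node big if it has descendants outside [G] at arbitrarily great depths. If the root is
    big, finite branching yields a big child again and again; the resulting path avoids [G], because
    [G] is hereditary. *)
Lemma konig G : (forall v, finite_set [set w | E v w]) -> heredit G ->
  (forall w : nat -> N, w 0%N = r -> (forall n, E (w n) (w n.+1)) ->
     exists n, G (w n)) ->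
  exists n, forall v, (n <= depth v)%N -> G v.
Proof.
move=> fin hG cover; apply: contrapT => /forallNP noG.
pose big v := forall n, exists v',
  [/\ anc v' (depth v) = v, (n <= depth v')%N & ~ G v'].
have bigr : big r.
  move=> n; have /existsNP[v /not_implyP[nv Gv]] := noG n.
  by exists v; split => //; rewrite depth_root; apply: depth0; rewrite depth_anc.
have bigS v : big v -> exists w, E v w /\ big w.
  move=> bv; apply: contrapT => /forallNP nobig.
  have /choice[nf nfP] : forall w, exists n, E v w -> forall v',
      anc v' (depth w) = w -> (n <= depth v')%N -> G v'.
    move=> w; have [vw|nvw] := pselect (E v w); last by exists 0%N.
    have /existsNP[n nP] : ~ big w by move=> bw; apply: (nobig w).
    exists n => _ v' av' nv'; apply: contrapT => Gv'.
    by apply: nP; exists v'.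
  (* A depth beyond the bounds of all children at once, and beyond [v], so that the descendant lies
     below some child. *)
  have [v' [av' nv' Gv']] :=
    bv (maxn (depth v).+1 (\max_(w <- fset_set [set w | E v w]) nf w)).
  move: nv'; rewrite geq_max => /andP[dv' nv'].
  have vw : E v (anc v' (depth v).+1) by rewrite -{1}av'; exact: edge_anc.
  apply: Gv'; apply: (nfP (anc v' (depth v).+1)) => //.
    by rewrite depth_anc.
  apply: leq_trans nv'.
  apply: (leq_bigmax_seq _ _ isT).
  by rewrite in_fset_set// inE.
have /choice[f fP] : forall v, exists w, big v -> E v w /\ big w.
  move=> v; have [/bigS[w wP]|nb] := pselect (big v); first by exists w.
  by exists v.
have bigw n : big (iter n f r) by elim: n => [//|n /fP[]].
have [] := cover (fun n => iter n f r) erefl (fun n => (fP _ (bigw n)).1).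
move=> n Gn; have [v' [av' _]] := bigw n 0%N; apply.
by move: Gn; rewrite -{1}av'; exact: heredit_anc.
Qed.

End Rooted.

(** * Random paths stopped at a given depth *)

Section Flow.
Context {R : realType} {N : choiceType}.
Variables (E : N -> N -> Prop) (r : N) (p : N -> R).
Implicit Types (A B G : N -> Prop).
Local Notation tip := (tip E).
Local Notation depth := (depth E r).
Local Notation anc := (anc E r).
Local Notation heredit := (heredit E).

Definition succs v : seq N :=
  if `[< tip v >] then [:: v] else fset_set [set w | E v w].

(* The nodes at depth [n] together with the leaves above them: the law of a
   random path stopped at a leaf, after [n] steps. *)
Fixpoint frontier n : seq N :=
  if n is n'.+1 then flatten [seq succs v | v <- frontier n'] else [:: r].

(** The probability that the random path, stopped after [n] steps, is in [A]. *)
Definition pr n A : R := \sum_(v <- frontier n | `[< A v >]) p v.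

Definition leaf_sum : \bar R := \esum_(v in [set v | tip v]) (p v)%:E.

Hypothesis ft : flow_tree E r p.
Let tree : directed_tree E r := ft_tree ft.

Lemma mem_succs v w : (w \in succs v) <-> (E v w \/ (tip v /\ w = v)).
Proof.
rewrite /succs; case: asboolP => [tv|ntv].
  by rewrite inE; split => [/eqP ->|[/tv//|[_ ->]]] //; right.
rewrite in_fset_set; last exact: (ft_fin ft).
by rewrite inE /=; split => [|[|[]]] //; left.
Qed.

Lemma sum_succs v : \sum_(w <- succs v) p w = p v.
Proof.
rewrite /succs; case: asboolP => [tv|ntv]; first by rewrite big_seq1.
by apply: (ft_flow ft); have [w] := not_tip ntv; exists w.
Qed.

Lemma p_ge0 v : 0 <= p v. Proof. exact: ltW (ft_pos ft v). Qed.

Lemma mem_frontier n v :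
  (v \in frontier n) <-> (depth v = n \/ (tip v /\ (depth v <= n)%N)).
Proof.
elim: n v => [|n IH] v /=.
  rewrite inE; split => [/eqP ->|]; first by left; rewrite depth_root.
  by case=> [/(depth0 tree) ->//|[_]]; rewrite leqn0 => /eqP/(depth0 tree) ->.
split=> [/flattenP[_ /mapP[u un ->]]|].
  move=> /mem_succs[uv|[tu ->]]; last first.
    by right; split=> //; case: (iffLR (IH _) un) => [->//|[_ /leqW]].
  left; rewrite (depth_edge tree uv); congr S.
  by case: (iffLR (IH _) un) => // -[tu]; case: (tu v).
move=> dv.
have [vn|nvn] := pselect (v \in frontier n).
  apply/flattenP; exists (succs v); first exact: map_f.
  apply/mem_succs; have [tv|ntv] := pselect (tip v); first by right.
  have [w vw] := not_tip ntv.
  case: dv => [dv|[tv]]; last by case: (tv w).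
  case: (iffLR (IH _) vn) => [|[tv]]; last by case: (tv w).
  by rewrite dv => /esym/n_Sn.
have {}dv : depth v = n.+1.
  case: dv => // -[tv]; rewrite leq_eqVlt => /orP[/eqP//|dn].
  by case: nvn; apply/IH; right.
have [u uv du] := depthS tree dv.
apply/flattenP; exists (succs u); last by apply/mem_succs; left.
by apply: map_f; apply/IH; left.
Qed.

Lemma uniq_frontier n : uniq (frontier n).
Proof.
elim: n => [//|n IH] /=; apply: uniq_flatten_map => //.
  by move=> v _; rewrite /succs; case: ifP => // _; exact: fset_uniq.
(* A parent is no tip, so in the frontier it has depth exactly [n], and its child is too deep to be
   there. *)
have aux u v : u \in frontier n -> tip u -> E v u -> v \in frontier n -> False.
  move=> /mem_frontier un tu vu /mem_frontier vn.
  have du := depth_edge tree vu.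
  have dun : (depth u <= n)%N by case: un => [->//|[]].
  case: vn => [dv|[tv]]; last by case: (tv u).
  by rewrite du dv ltnn in dun.
have [_ up _] := tree.
move=> u v un vn w /mem_succs[uw|[tu ->]] /mem_succs[vw|[tv e]].
- exact: up uw vw.
- by exfalso; move: uw; rewrite e => uv; apply: aux vn tv uv un.
- by exfalso; apply: aux un tu vw vn.
- by [].
Qed.

Lemma frontier_depth n v : v \in frontier n -> (depth v <= n)%N.
Proof. by move=> /mem_frontier[->|[]]. Qed.

Lemma pr_ge0 n A : 0 <= pr n A.
Proof. by apply: sumr_ge0 => v _; exact: p_ge0. Qed.

Lemma pr_sub n A B : (forall v, v \in frontier n -> A v -> B v) ->
  pr n A <= pr n B.
Proof.
move=> AB; rewrite /pr big_mkcond [leRHS]big_mkcond /=.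
apply: ler_sum_in => v vn; case: asboolP => [/(AB _ vn)/asboolP ->//|_].
by case: ifP => // _; exact: p_ge0.
Qed.

Lemma pr_split n A B : pr n A = pr n (fun v => A v /\ B v) +
  pr n (fun v => A v /\ ~ B v).
Proof.
rewrite /pr (bigID (fun v => `[< B v >])) /=; congr (_ + _); apply: eq_bigl => v.
  by rewrite asbool_and.
by rewrite asbool_and asbool_neg.
Qed.

Lemma pr_or n A B : pr n (fun v => A v \/ B v) <= pr n A + pr n B.
Proof.
rewrite (pr_split n _ A); apply: lerD; apply: pr_sub => v _ [] //.
by case.
Qed.

Lemma pr_exists_lt n (A : nat -> N -> Prop) m :
  pr n (fun v => exists2 i, (i < m)%N & A i v) <= \sum_(i < m) pr n (A i).
Proof.
elim: m => [|m IH].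
  rewrite big_ord0; apply: (le_trans (pr_sub (B := fun=> False) _)).
    by move=> v _ [].
  by rewrite /pr big_pred0// => v; apply/negbTE; apply/asboolPn.
rewrite big_ord_recr /=; apply: le_trans (lerD IH (lexx _)).
apply: le_trans (pr_or _ _ _); apply: pr_sub => v _ [i].
by rewrite ltnS leq_eqVlt => /orP[/eqP ->|im] Ai; [right|left; exists i].
Qed.

(** The mass of a node is passed on entirely to its successors, a tip being its own successor. *)
Lemma pr_step n A B :
  (forall v w, v \in frontier n -> A v -> E v w -> B w) ->
  (forall v, v \in frontier n -> A v -> tip v -> B v) ->
  pr n A <= pr n.+1 B.
Proof.
move=> ABs ABt; rewrite /pr /= big_flatten big_map [leLHS]big_mkcond /=.
apply: ler_sum_in => v vn; case: asboolP => Av; last first.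
  by apply: sumr_ge0 => w _; exact: p_ge0.
rewrite -(sum_succs v) big_seq [leRHS]big_seq_cond.
rewrite [leRHS](eq_bigl (fun w => w \in succs v)) // => w.
case: (boolP (w \in succs v)) => //= /mem_succs vw; apply/asboolP.
by case: vw => [|[tv ->]]; [exact: ABs|exact: ABt].
Qed.

Lemma pr_heredit n m A : heredit A -> (n <= m)%N -> pr n A <= pr m A.
Proof.
move=> hA; elim: m => [|m IH]; first by rewrite leqn0 => /eqP ->.
rewrite leq_eqVlt => /orP[/eqP ->//|/IH/le_trans]; apply.
by apply: pr_step => // v w _ Av vw; exact: hA Av.
Qed.

Lemma pr_true n A : (forall v, A v) -> pr n A = 1.
Proof.
move=> AT; rewrite /pr (eq_bigl xpredT); last by move=> v; apply/asboolP.
elim: n => [|n IH] /=; first by rewrite big_seq1 (ft_root ft).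
rewrite big_flatten big_map -[RHS]IH; apply: eq_bigr => v _; exact: sum_succs.
Qed.

Lemma p_le1 v : p v <= 1.
Proof.
rewrite -(pr_true (depth v) (A := fun=> True))// /pr.
rewrite (eq_bigl xpredT); last by move=> w; exact/asboolP.
have -> : p v = \sum_(w <- [:: v]) p w by rewrite big_seq1.
apply: ler_sum_subset => [//||w]; last exact: p_ge0.
by move=> w; rewrite inE => /eqP ->; apply/mem_frontier; left.
Qed.

Lemma pr_not n A : pr n A + pr n (fun v => ~ A v) = 1.
Proof.
rewrite -[RHS](pr_true n (A := fun=> True)) // [RHS](pr_split n _ A).
by congr (_ + _); rewrite /pr; apply: eq_bigl => v; apply/asbool_equiv_eq;
  split => // -[].
Qed.

Lemma pr_le1 n A : pr n A <= 1.
Proof. by rewrite -(pr_not n A) lerDl pr_ge0. Qed.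

Lemma pr_anc n m A : (n <= m)%N -> pr m (fun v => A (anc v n)) = pr n A.
Proof.
move=> nm.
have le B : pr n B <= pr m (fun v => B (anc v n)).
  elim: m nm => [|m IH].
    rewrite leqn0 => /eqP ->; apply: pr_sub => v /frontier_depth dv.
    by rewrite anc_id.
  rewrite leq_eqVlt => /orP[/eqP ->|nm].
    by apply: pr_sub => v /frontier_depth dv; rewrite anc_id.
  apply: le_trans (IH nm) _; apply: pr_step => // v w /mem_frontier vm Bv vw.
  case: vm => [dv|[tv]]; last by case: (tv w).
  by rewrite (anc_edge _ _ vw)// dv -ltnS nm.
(* The inequality [le] also holds for the complement of [A]; as both pairs of masses add up to 1, it
   is an equality. *)
apply/eqP; rewrite eq_le le andbT.
rewrite -(lerD2r (pr m (fun v => ~ A (anc v n)))) pr_not -(pr_not n A).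
by rewrite lerD2l; exact: (le (fun v => ~ A v)).
Qed.

(** Tips stay in all later frontiers, so the frontier at the greatest depth occurring in [X]
    contains [X]. *)
Lemma sum_tips_le (X : {fset N}) : (forall v, v \in X -> tip v) ->
  exists n, \sum_(v <- X) p v <= pr n tip.
Proof.
move=> Xt; exists (\max_(v <- X) depth v)%N.
rewrite /pr -[leRHS]big_filter; apply: ler_sum_subset; first exact: fset_uniq.
  move=> v vX; rewrite mem_filter; apply/andP; split.
    by apply/asboolP; exact: Xt.
  apply/mem_frontier; right; split; first exact: Xt.
  exact: (leq_bigmax_seq _ vX isT).
exact: p_ge0.
Qed.

Lemma fsets_tips (X : set N) : fsets [set v | tip v] X ->
  (\sum_(v \in X) (p v)%:E)%E = (\sum_(v <- fset_set X) p v)%:E /\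
  (forall v, v \in fset_set X -> tip v).
Proof.
move=> [finX Xt]; rewrite fsbig_finite//= sumEFin; split=> // v.
by rewrite in_fset_set// inE => /Xt.
Qed.

Lemma leaf_sum_le1 : (leaf_sum <= 1)%E.
Proof.
apply: ge_ereal_sup => _ [X /fsets_tips[-> Xt] <-].
have [n /le_trans] := sum_tips_le Xt.
by move=> /(_ _ (pr_le1 n tip)); rewrite lee_fin.
Qed.

(** Non-tips of the frontier carry the mass not yet absorbed by leaves of depth at most [n]. *)
Lemma leaf_sum1_pr : leaf_sum = 1%E ->
  forall eps, 0 < eps -> exists n, pr n (fun v => ~ tip v) <= eps.
Proof.
move=> ls eps eps0.
have : ((1 - eps)%:E < leaf_sum)%E by rewrite ls lte_fin ltrBlDr ltrDl.
move=> /ereal_sup_gt[_ [X /fsets_tips[-> Xt] <-]]; rewrite lte_fin => Xe.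
have [n Xn] := sum_tips_le Xt; exists n.
have := pr_not n tip; have := lt_le_trans Xe Xn.
rewrite ltrBlDr => h /eqP; rewrite eq_sym addrC -subr_eq => /eqP <-.
by rewrite lerBlDl ltW.
Qed.

Lemma pr_leaf_sum1 :
  (forall eps, 0 < eps -> exists n, pr n (fun v => ~ tip v) <= eps) ->
  leaf_sum = 1%E.
Proof.
move=> H; apply/eqP; rewrite eq_le leaf_sum_le1 /=.
apply/lee_addgt0Pr => eps /H[n nP].
have fin : finite_set [set` [seq v <- frontier n | `[< tip v >]]].
  exact: finite_seq.
have : ((pr n tip)%:E <= leaf_sum)%E.
  apply: esum_ge; exists [set` [seq v <- frontier n | `[< tip v >]]].
    split=> // v /=; rewrite mem_filter => /andP[/asboolP].
    by [].
  rewrite fsbig_finite//= sumEFin lee_fin /pr -[leLHS]big_filter.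
  apply: ler_sum_subset; last exact: p_ge0.
    by rewrite filter_uniq// uniq_frontier.
  by move=> v vf; rewrite in_fset_set// inE.
move=> /(leeD2r eps%:E); apply: le_trans.
by rewrite -EFinD lee_fin -(pr_not n tip) lerD2l.
Qed.

(** Outer measure zero: [G] encodes the open set of paths that enter it. Heredity makes [pr n G]
    nondecreasing in [n], so the uniform bound is a bound on its limit. *)
Definition null (A : set (nat -> N)) : Prop := forall eps, 0 < eps ->
  exists G, [/\ heredit G, forall n, pr n G <= eps
    & forall w, A w -> exists n, G (w n)].

Lemma sub_null (A B : set (nat -> N)) : A `<=` B -> null B -> null A.
Proof.
by move=> AB nB eps /nB[G [hG Ge cov]]; exists G; split=> // w /AB; exact: cov.
Qed.

Lemma geometric_sum_lt (eps : R) m : 0 < eps ->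
  \sum_(i < m) eps / 2 ^+ i.+1 < eps.
Proof.
move=> eps0; have -> : \sum_(i < m) eps / 2 ^+ i.+1 = eps - eps / 2 ^+ m.
  elim: m => [|m IH]; first by rewrite big_ord0 expr0 divr1 subrr.
  rewrite big_ord_recr /= IH exprS; field.
  by rewrite expf_neq0.
by rewrite ltrBlDr ltrDl divr_gt0// exprn_gt0.
Qed.

Lemma null_bigcup (A : nat -> set (nat -> N)) :
  (forall i, null (A i)) -> null (\bigcup_i A i).
Proof.
move=> nA eps eps0.
have /choice[G GP] : forall i, exists G, [/\ heredit G,
    forall n, pr n G <= eps / 2 ^+ i.+1 & forall w, A i w -> exists n, G (w n)].
  by move=> i; apply: nA; rewrite divr_gt0// exprn_gt0.
exists (fun v => exists i, G i v); split.
- by move=> v w vw [i Giv]; exists i; have [hG _ _] := GP i; exact: hG Giv.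
- move=> n.
  (* The frontier is finite, so choosing one index per node leaves a finite union, bounded by a
     partial geometric sum. *)
  have /choice[f fP] : forall v, exists i, (exists i, G i v) -> G i v.
    move=> v; have [[i Gi]|nG] := pselect (exists i, G i v); first by exists i.
    by exists 0%N.
  apply: le_trans (ltW (geometric_sum_lt (\max_(v <- frontier n) f v).+1 eps0)).
  apply: (@le_trans _ _ (\sum_(i < (\max_(v <- frontier n) f v).+1) pr n (G i))).
    apply: le_trans (pr_exists_lt _ _ _); apply: pr_sub => v vn /fP Gv.
    by exists (f v) => //; rewrite ltnS; exact: (leq_bigmax_seq _ vn isT).
  by apply: ler_sum => i _; have [_ -> _] := GP i.
- move=> w [i _ Aw]; have [_ _ /(_ _ Aw)[n Gn]] := GP i; exists n.
  by exists i.
Qed.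

Lemma null_set0 : null set0.
Proof.
move=> eps eps0; exists (fun=> False); split=> [//|n|//].
by rewrite /pr big_pred0 ?ltW// => v; apply/negbTE; apply/asboolPn.
Qed.

Lemma null_bigcup_seq (I : eqType) (s : seq I) (A : I -> set (nat -> N)) :
  (forall i, null (A i)) -> null [set w | exists2 i, i \in s & A i w].
Proof.
move=> nA; elim: s => [|i s IH].
  by apply: sub_null null_set0 => w [].
apply: sub_null (null_bigcup (A := fun n => if n is 0%N then A i else
    [set w | exists2 i, i \in s & A i w]) _); last by case.
move=> w [j]; rewrite inE => /orP[/eqP ->|js] Aj; first by exists 0%N.
by exists 1%N => //=; exists j.
Qed.

(** By König's lemma a cover of all infinite paths contains every node of some depth [n]; the
    shallower nodes of that frontier are tips. *)
Lemma null_leaf_sum1 :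
  null [set w | w 0%N = r /\ forall n, E (w n) (w n.+1)] -> leaf_sum = 1%E.
Proof.
move=> nA; apply: pr_leaf_sum1 => eps /nA[G [hG Ge cov]].
have [n nG] := konig tree (ft_fin ft) hG
  (fun w w0 wE => cov w (conj w0 wE)).
exists n; apply: le_trans (Ge n); apply: pr_sub => v /mem_frontier vn ntv.
by apply: nG; case: vn => [->//|[]].
Qed.

End Flow.

(** * Subtrees restarted at a node and pruned *)

Section Restriction.
Context {R : realType} {N : choiceType}.
Variables (E : N -> N -> Prop) (r : N) (p : N -> R).
Variables (u : N) (cut : N -> Prop).
Implicit Types (v w : N).
Local Notation dep := (depth E r).

(** A node of [cut] is kept and becomes a leaf; only its outgoing edges disappear. *)
Definition redge v w := E v w /\ ~ cut v.
Definition below v := clos_refl_trans N redge u v.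
(** A subtype, because a labelled tree has its whole node type as node set. *)
Definition rnode : choiceType := {v : N | `[< below v >]}.
Definition rE (a b : rnode) := redge (sval a) (sval b).
Definition rroot : rnode := exist _ u (asboolT (rt_refl N redge u)).
Definition rp (a : rnode) : R := p (sval a) / p u.

Lemma sval_inj : injective (fun a : rnode => sval a).
Proof. by move=> a b; exact: val_inj. Qed.

Lemma belowP (a : rnode) : below (sval a).
Proof. exact: asboolW (svalP a). Qed.

Definition rnode_of v (bv : below v) : rnode := exist _ v (asboolT bv).

Lemma below_redge v w : below v -> redge v w -> below w.
Proof. by move=> bv vw; apply: rt_trans bv _; exact: rt_step. Qed.

Hypothesis ft : flow_tree E r p.
Let tree : directed_tree E r := ft_tree ft.

Lemma below_depth v : below v -> (dep u <= dep v)%N.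
Proof.
move/clos_rt_rtn1_iff; elim=> // y z [yz _] _ /leq_trans; apply.
by rewrite (depth_edge tree yz).
Qed.

Lemma rtree : directed_tree rE rroot.
Proof.
have [_ up _] := tree; split.
- move=> a [au _]; have := below_depth (belowP a).
  by rewrite (depth_edge tree au) /= ltnn.
- by move=> a b c [ac _] [bc _]; apply: sval_inj; exact: up ac bc.
- move=> a; have /clos_rt_rtn1_iff := belowP a.
  move e: (sval a) => v bv; elim: bv a e => [a e|y z yz by_ IH a e].
    by rewrite (_ : a = rroot) //; [exact: rt_refl|exact: sval_inj].
  have {}by_ : below y by apply/clos_rt_rtn1_iff.
  apply: rt_trans (IH (rnode_of by_) erefl) _; apply: rt_step.
  by rewrite /rE e.
Qed.

Lemma rfinite a : finite_set [set b | rE a b].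
Proof.
apply: (@sub_finite_set _ _
  ((fun b : rnode => sval b) @^-1` [set w | E (sval a) w])).
  by move=> b [].
apply: finite_preimage; last exact: (ft_fin ft).
by move=> b c _ _; exact: sval_inj.
Qed.

Lemma perm_rchildren a : ~ cut (sval a) ->
  perm_eq [seq sval b | b <- fset_set [set b | rE a b]]
    (fset_set [set w | E (sval a) w]).
Proof.
move=> nc; apply: uniq_perm.
- by rewrite map_inj_uniq; [exact: fset_uniq|exact: sval_inj].
- exact: fset_uniq.
move=> w; rewrite in_fset_set; last exact: (ft_fin ft).
apply/mapP/idP => [[b + ->]|].
  by rewrite in_fset_set; [rewrite !inE => -[]|exact: rfinite].
rewrite inE /= => aw; have bw : below w by apply: below_redge (belowP a) _.
by exists (rnode_of bw) => //; rewrite in_fset_set ?inE//; exact: rfinite.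
Qed.

Lemma rflow : flow_tree rE rroot rp.
Proof.
split; [exact: rtree|exact: rfinite| | |].
- by rewrite /rp /= divff// gt_eqF// (ft_pos ft).
- by move=> a; rewrite divr_gt0// (ft_pos ft).
move=> a [b ab]; rewrite /rp -mulr_suml -(big_map _ xpredT p).
rewrite (perm_big _ (perm_rchildren ab.2)) (ft_flow ft)//.
by exists (sval b); case: ab.
Qed.

Lemma rdepth a : (dep u + depth rE rroot a)%N = dep (sval a).
Proof.
move: a; apply: (tree_induction rtree) => [|a b ab IH].
  by rewrite (depth_root rtree) addn0.
by rewrite (depth_edge rtree ab) addnS IH (depth_edge tree ab.1).
Qed.

Lemma rtip a : tip rE a <-> (tip E (sval a) \/ cut (sval a)).
Proof.
split=> [ta|[ta|ca] b []]; last 2 first.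
- by move=> /ta.
- by [].
have [ca|nca] := pselect (cut (sval a)); [by right|left] => w aw.
have bw : below w by apply: below_redge (belowP a) _.
exact: (ta (rnode_of bw)).
Qed.

(** The shift by [dep u] and the factor [p u] undo the restart at [u]. The inequality may be strict:
    a node cut early stays in the frontier of the pruned tree but not in the original one. *)
Lemma pr_restrict n (A : N -> Prop) :
  pr E r p (dep u + n) (fun v => below v /\ A v) <=
  p u * pr rE rroot rp n (fun a => A (sval a)).
Proof.
have pu : p u != 0 by rewrite gt_eqF// (ft_pos ft).
rewrite /pr /rp -mulr_suml mulrCA divff// mulr1 -[leLHS]big_filter.
rewrite -[leRHS]big_filter -(big_map (fun a : rnode => sval a) xpredT p).
apply: ler_sum_subset => [||v]; last exact: ltW (ft_pos ft v).
  by rewrite filter_uniq//; exact: uniq_frontier ft _.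
move=> v; rewrite mem_filter => /andP[/asboolP[bv Av]] vn.
apply/mapP; exists (rnode_of bv) => //; rewrite mem_filter.
apply/andP; split; first exact/asboolP.
apply/(mem_frontier rflow).
have := rdepth (rnode_of bv) => /= dv.
case: (iffLR (mem_frontier ft _ _) vn) => [|[tv]]; rewrite -dv.
  by move=> /addnI ->; left.
by rewrite leq_add2l => d; right; split=> //; apply/rtip; left.
Qed.

End Restriction.

(** * Counting visits to a set of nodes *)

Section Cut.
Context {R : realType} {N : choiceType}.
Variables (E : N -> N -> Prop) (r : N) (p : N -> R) (D : N -> Prop).
Local Notation depth := (depth E r).
Local Notation anc := (anc E r).
Local Notation pr := (pr E r p).

(** Visits to [D] at strict ancestors: a node counts itself only on the edges that leave it. *)
Definition count : N -> nat :=
  treefun E r 0%N (fun v _ c => (c + `[< D v >])%N).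

Hypothesis ft : flow_tree E r p.
Let tree : directed_tree E r := ft_tree ft.

Lemma count_edge v w : E v w -> count w = (count v + `[< D v >])%N.
Proof. by move=> vw; rewrite /count (treefun_edge tree _ _ vw). Qed.

Lemma count_depth v : (count v <= depth v)%N.
Proof.
move: v; apply: (tree_induction tree) => [|v w vw IH].
  by rewrite /count (treefun_root tree).
rewrite (count_edge vw) (depth_edge tree vw) -addn1.
by apply: leq_add => //; case: asboolP.
Qed.

Lemma heredit_count k : heredit E (fun v => (k <= count v)%N).
Proof. by move=> v w vw kv; rewrite (count_edge vw) (leq_trans kv)// leq_addr. Qed.

Lemma path_count_unbounded (w : nat -> N) : (forall n, E (w n) (w n.+1)) ->
  (forall n, exists2 m, (n <= m)%N & D (w m)) ->
  forall k, exists n, (k <= count (w n))%N.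
Proof.
move=> wE wD; elim=> [|k [n kn]]; first by exists 0%N.
have [m nm Dm] := wD n; exists m.+1.
rewrite (count_edge (wE m)) asboolT//= addn1 ltnS (leq_trans kn)//.
elim: m nm {Dm} => [|m IH]; first by rewrite leqn0 => /eqP ->.
rewrite leq_eqVlt => /orP[/eqP ->//|/IH/leq_trans]; apply.
by rewrite (count_edge (wE m)) leq_addr.
Qed.

Lemma below_uncut (cut : N -> Prop) v :
  (forall j, (j < depth v)%N -> ~ cut (anc v j)) -> below E r cut v.
Proof.
move: v; apply: (tree_induction tree) => [_|v w vw IH uncut].
  exact: rt_refl.
apply: below_redge (IH _) _ => [j jv|].
  have := uncut j; rewrite (depth_edge tree vw) (anc_edge tree _ vw) (ltnW jv).
  by apply; exact: ltnW.
split=> //; have := uncut (depth v); rewrite (depth_edge tree vw).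
by move=> /(_ (leqnn _)); rewrite (anc_edge tree _ vw) leqnn (anc_id tree).
Qed.

(* If infinitely many nodes of [D] were visited with positive probability,
   cutting at depth [M i] the nodes that have not yet visited [i] of them
   would lose little of that probability, by the choice of [M], and leave a
   tree each of whose infinite paths visits [D] infinitely often. *)
Lemma pr_count_small :
  (forall cut : N -> Prop,
    (forall w : nat -> N, (forall n, redge E cut (w n) (w n.+1)) ->
       forall n, exists2 m, (n <= m)%N & D (w m)) ->
    leaf_sum (@rE _ E r cut) (rp p (u := r) (cut := cut)) = 1%E) ->
  forall eps, 0 < eps ->
  exists k, forall n, pr n (fun v => (k <= count v)%N) <= eps.
Proof.
move=> AST eps eps0; apply: contrapT => /forallNP large.
(* At depth [M i] the probability of [i] visits is nearly its supremum, with errors summing to less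
   than [eps / 2]. Since [i <= M i], a cut at depth at most [n] has index at most [n]. *)
have /choice[M MP] : forall i, exists M, (i <= M)%N /\ forall m,
    pr m (fun v => (i <= count v)%N) <=
    pr M (fun v => (i <= count v)%N) + eps / 2 / 2 ^+ i.+1.
  move=> i; pose S := range (fun m => pr m (fun v => (i <= count v)%N)).
  have Ssup : has_sup S.
    split; first by exists (pr 0 (fun v => (i <= count v)%N)), 0%N.
    by exists 1 => _ [m _ <-]; exact: pr_le1.
  have d0 : 0 < eps / 2 / 2 ^+ i.+1 by rewrite !divr_gt0// exprn_gt0.
  have [_ [m _ <-] mS] := sup_adherent d0 Ssup.
  exists (maxn i m); split=> [|m']; first exact: leq_maxl.
  rewrite -lerBlDr; apply: le_trans (_ : pr m (fun v => (i <= count v)%N) <= _).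
    apply: le_trans (ltW mS); rewrite lerB//.
    by apply: ub_le_sup => //; [case: Ssup|exists m'].
  by apply: (pr_heredit ft) (leq_maxr _ _); exact: heredit_count.
pose cut v := exists2 i, depth v = M i & (count v < i)%N.
have {}AST : leaf_sum (@rE _ E r cut) (rp p (u := r) (cut := cut)) = 1%E.
  apply: AST => w wE n; apply: contrapT => noD.
  have wE' m : E (w m) (w m.+1) by case: (wE m).
  have cst m : (n <= m)%N -> count (w m) = count (w n).
    elim: m => [|m IH]; first by rewrite leqn0 => /eqP ->.
    rewrite leq_eqVlt => /orP[/eqP ->//|nm].
    rewrite (count_edge (wE' m)) IH// asboolF ?addn0// => Dm.
    by apply: noD; exists m.
  (* This index exceeds the stable count, and [M i] is at least the depth of [w n]: the path would
     be cut at depth [M i]. *)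
  pose i := (count (w n) + depth (w n)).+1.
  have [Mi _] := MP i.
  have dn := path_depth tree wE'.
  pose m := (M i - depth (w 0%N))%N.
  have w0M : (depth (w 0%N) + n <= M i)%N.
    by rewrite -dn (leq_trans _ Mi)// /i; lia.
  have [_] := wE m; apply; exists i; first by rewrite dn /m; lia.
  by rewrite cst; [rewrite /i; lia|rewrite /m; lia].
have rft := rflow r cut ft.
have e4 : 0 < eps / 4 by lra.
have e2 : 0 < eps / 2 by lra.
have [n nP] := leaf_sum1_pr rft AST e4.
(* With [n.+1] visits a node is deeper than [n], so its ancestor at depth [n] is not a tip. *)
have /existsNP[m0 /negP] := large n.+1; rewrite -ltNge => m0P.
pose m := maxn m0 (maxn n (\max_(i < n.+1) M i)).
have mA : eps < pr m (fun v => (n.+1 <= count v)%N).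
  apply: lt_le_trans m0P _; apply: (pr_heredit ft); first exact: heredit_count.
  exact: leq_maxl.
have nm : (n <= m)%N by rewrite /m !leq_max leqnn orbT.
have Mm i : (i < n.+1)%N -> (M i <= m)%N.
  move=> il; rewrite /m !leq_max; apply/orP; right; apply/orP; right.
  exact: (leq_bigmax (Ordinal il)).
(* A node with more than [n] visits either is still running in the pruned tree at depth [n], which
   is [B], or was cut at some depth [M i] before its visit number [i], which is [C i]. These events
   weigh at most [eps / 4] and [eps / 2] in total. *)
pose B v := below E r cut (anc v n) /\ ~ (tip E (anc v n) \/ cut (anc v n)).
pose C i v := (i <= count v)%N /\ ~ (i <= count (anc v (M i)))%N.
have mB : pr m B <= eps / 4.
  rewrite (pr_anc ft (fun v => below E r cut v /\ ~ (tip E v \/ cut v)))//.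
  have := pr_restrict r cut ft n (fun v => ~ (tip E v \/ cut v)).
  rewrite (depth_root tree) add0n (ft_root ft) mul1r => /le_trans; apply.
  apply: le_trans nP; apply: (pr_sub rft) => a _ ta /rtip.
  exact: ta.
have mC i : (i < n.+1)%N -> pr m (C i) <= eps / 2 / 2 ^+ i.+1.
  move=> il; have := pr_split E r p m (fun v => (i <= count v)%N)
    (fun v => (i <= count (anc v (M i)))%N).
  have -> : pr m (fun v => (i <= count v)%N /\ (i <= count (anc v (M i)))%N) =
     pr (M i) (fun v => (i <= count v)%N).
    rewrite -(pr_anc ft _ (Mm i il)); apply/eqP; rewrite eq_le.
    rewrite !(pr_sub ft)// => v _ h; last by case: h.
    by split=> //; apply: (heredit_anc tree (heredit_count (k := i))) h.
  have [_ /(_ m)] := MP i; rewrite /C; lra.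
have : pr m (fun v => (n.+1 <= count v)%N) <=
    pr m B + \sum_(i < n.+1) pr m (C i).
  apply: le_trans (lerD (lexx _) (pr_exists_lt ft _ _ _)).
  apply: le_trans (pr_or ft _ _ _); apply: (pr_sub ft) => v _ nv.
  have ndv : (n < depth v)%N := leq_trans nv (count_depth v).
  have da : depth (anc v n) = n by rewrite (depth_anc tree)// ltnW.
  have [[j jn cj]|nocut] := pselect (exists2 j, (j <= n)%N & cut (anc v j)).
    have dj : depth (anc v j) = j.
      by rewrite (depth_anc tree)// (leq_trans jn)// ltnW.
    case: cj => i; rewrite dj => ji ci.
    have iM : (i <= n)%N by rewrite (leq_trans (MP i).1)// -ji.
    right; exists i => //; split; first by rewrite (leq_trans _ nv)// leqW.
    by rewrite -ji; apply/negP; rewrite -ltnNge.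
  left; split.
    apply: below_uncut => j; rewrite da => jn cj; apply: nocut; exists j.
      exact: ltnW.
    have -> : anc v j = anc (anc v n) j; last exact: cj.
    by rewrite (anc_anc tree)// ltnW.
  case=> [ta|ca]; last by apply: nocut; exists n.
  by apply: (ta (anc v n.+1)); exact: (edge_anc tree).
have : \sum_(i < n.+1) pr m (C i) <= eps / 2.
  apply: le_trans (ltW (geometric_sum_lt n.+1 e2)).
  by apply: ler_sum => i _; exact: mC.
lra.
Qed.

End Cut.

(** * Infinite paths and the dependency graph *)

Lemma bounded_of_injective (T : eqType) (S : nat -> Prop) (f : nat -> T)
    (L : seq T) :
  (forall n, S n -> f n \in L) ->
  (forall n m, S n -> S m -> f n = f m -> n = m) ->
  exists B, forall n, (B <= n)%N -> ~ S n.
Proof.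
elim: L S => [|a L IH] S fL finj; first by exists 0%N => n _ /fL.
have [B BP] := IH (fun n => S n /\ f n <> a)
  (fun n '(conj Sn na) =>
     ltac:(by move: (fL n Sn); rewrite inE => /orP[/eqP|]))
  (fun n m '(conj Sn _) '(conj Sm _) => finj n m Sn Sm).
have [[n0 [Sn0 fn0]]|no] := pselect (exists n, S n /\ f n = a).
  exists (maxn B n0.+1) => n; rewrite geq_max => /andP[Bn n0n] Sn.
  apply: (BP n Bn); split=> // fn.
  by move: n0n; rewrite (finj n n0)// ?ltnn// fn.
by exists B => n Bn Sn; apply: (BP n Bn); split=> // fn; apply: no; exists n.
Qed.

(** Maximality is stated for a preorder, as mutually reachable ADPs may differ. The candidate [b]
    gives way to [d] only if [le d b] holds without its converse. *)
Lemma maximal_above (T : eqType) (le : T -> T -> Prop) (I : T -> Prop)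
    (L : seq T) :
  (forall a, le a a) -> (forall a b c, le a b -> le b c -> le a c) ->
  forall a, I a -> exists b, [/\ I b, le b a &
    forall c, c \in L -> I c -> le c b -> le b c].
Proof.
move=> lexx letr; elim: L => [|d L IH] a Ia; first by exists a.
have [b [Ib ba bmax]] := IH a Ia.
have [[Id db nbd]|nd] := pselect [/\ I d, le d b & ~ le b d].
  exists d; split=> //; first exact: letr db ba.
  move=> c; rewrite inE => /orP[/eqP -> //|cL] Ic cd.
  by apply: (letr _ _ _ db); apply: bmax => //; exact: letr db.
exists b; split=> // c; rewrite inE => /orP[/eqP ->|]; last exact: bmax.
by move=> Id db; apply: contrapT => nbd; apply: nd.
Qed.

HB.instance Definition _ R Sg V := gen_eqMixin (adp R Sg V).
HB.instance Definition _ R Sg V := gen_choiceMixin (adp R Sg V).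

Section DependencyGraphPaths.
Context {R : realType} {Sg : signature} {V : Type}.
Implicit Types (a b c : adp R Sg V) (y e : uterm Sg V) (q : seq nat).
Implicit Types (sigma : V -> uterm Sg V).

Lemma subterm_at_subst (F : Type) (ar : F -> nat) (W : Type)
    (sigma : W -> term ar W) (t u : term ar W) q :
  subterm_at t q = Some u -> subterm_at (subst sigma t) q = Some (subst sigma u).
Proof.
elim: q t => [|i q IH] [z|f g] //=; last by case: insub => // j; exact: IH.
- by move=> [<-] /=; rewrite subterm_at_nil.
- by move=> [<-].
Qed.

Lemma asubst_sharp sigma e f : root_sym e = Some f ->
  asubst sigma (sharp e) = sharp (subst sigma e).
Proof.
case: e => //= -[d|k] g _ /=; congr App; apply/funext => i;
  by rewrite emb_subst.
Qed.

Variable P : set (adp R Sg V).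

(** The redex lies strictly below the annotated root, which is left untouched. [ANF] makes the step
    innermost, since left-hand sides of [np P] come from [P]. *)
Lemma sharp_step y q a sigma (x : R * aterm Sg V) : q != [::] ->
  P a -> flag a -> x \in rhs a ->
  subterm_at y q = Some (subst sigma (lhs a)) ->
  ANF P (emb (subst sigma (lhs a))) ->
  innermost_step (np P) (sharp y)
    (sharp (replace y q (subst sigma (flat x.2)))).
Proof.
move=> q0 Pa fa xa yq anf.
exists (emb (lhs a)), (emb (flat x.2)), (emb \o sigma), q; split.
- by exists a, x.
- case: q q0 yq => // i q _; case: y => [//|[d|k] g] /=; case: insub => // j yq;
    by rewrite subterm_at_emb yq /= emb_subst.
- move=> q' u q'0; rewrite -emb_subst => /(anf _ _ q'0) nf q2 u2 uq2.
  move=> [l [tau [[_ [b [z [Pb _ _ ->]]] /= <-] u2E]]].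
  (* The substitution [tau] may introduce annotated terms; flattening turns the instance into one of
     a left-hand side of [P]. *)
  apply: (nf q2 (flat u2)); first by rewrite subterm_at_flat uq2.
  exists (lhs b), (@flat Sg V \o tau); split; first by exists b.
  by rewrite u2E flat_subst flat_emb.
- case: q q0 yq => // i q _; case: y => [//|[d|k] g] /= _; congr App;
    apply/funext => j; case: eqP => // _; by rewrite emb_replace emb_subst.
Qed.

(** Both paths are non-empty, so this set is empty when [a] lies on no cycle. *)
Definition scc a : set (adp R Sg V) :=
  [set b | clos_trans _ (dg_edge P) a b /\ clos_trans _ (dg_edge P) b a].

Lemma SCC_scc a : clos_trans _ (dg_edge P) a a -> SCC P (scc a).
Proof.
move=> aa; split.
- by exists a.
- by move=> b [_]; elim=> [c d []|].
- move=> b c Qb Qc.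
  have /clos_trans_t1n_iff : clos_trans _ (dg_edge P) b c.
    by apply: t_trans Qb.2 Qc.1.
  (* Every node on a path between two members is itself a member, so the path stays inside. *)
  move=> bc; elim: bc Qb Qc => [d e' de Qd Qe|d e' f de ef IH Qd Qf].
    by apply: t_step.
  have ef' : clos_trans _ (dg_edge P) e' f by apply/clos_trans_t1n_iff.
  have Qe : scc a e'.
    split; last exact: t_trans ef' Qf.2.
    by apply: t_trans Qd.1 _; exact: t_step.
  by apply: t_trans (IH Qe Qf); apply: t_step.
- move=> Q' QQ' Q'P sc; apply/seteqP; split=> [b Q'b|//].
  have sub c1 c2 :
      clos_trans _ (fun a1 a2 => [/\ Q' a1, Q' a2 & dg_edge P a1 a2]) c1 c2 ->
      clos_trans _ (dg_edge P) c1 c2.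
    elim=> [a1 a2 [_ _ a12]|a1 a2 a3 _ a12 _ a23]; first exact: t_step.
    exact: t_trans a12 a23.
  by split; apply: sub; apply: sc => //; apply: QQ'.
Qed.

Hypothesis hP : adp_problem P.

Lemma problem_def_root a : P a -> def_root a.
Proof. by move=> /hP.2[]. Qed.

(** * Annotations along an infinite sequence of moves *)

Variables (t : nat -> aterm Sg V) (al : nat -> adp R Sg V).
Variables (sg : nat -> V -> uterm Sg V) (pi : nat -> seq nat).
Variable (x : nat -> R * aterm Sg V).
Hypothesis t_redex : forall n, redex P (t n) (al n) (sg n) (pi n).
Hypothesis x_rhs : forall n, x n \in rhs (al n).
Hypothesis t_next : forall n,
  t n.+1 = next (t n) (flag (al n)) (sg n) (pi n) (x n).2.
Local Notation isP n := (ann (t n) (pi n)).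

Lemma alP n : P (al n). Proof. by case: (t_redex n). Qed.

Lemma redex_subterm n :
  subterm_at (flat (t n)) (pi n) = Some (subst (sg n) (lhs (al n))).
Proof.
by have /redexE[] := t_redex n; [exact: alP|exact: problem_def_root (alP n)|].
Qed.

Lemma redex_anf n : ANF P (emb (subst (sg n) (lhs (al n)))).
Proof. by case: (t_redex n). Qed.

Lemma ann_succ n q : ann (t n.+1) q =
  if prefix (pi n) q then isP n && ann (x n).2 (drop (size (pi n)) q)
  else ann (t n) q && (flag (al n) || ~~ prefix q (pi n)).
Proof. by rewrite t_next ann_next// redex_subterm. Qed.

(** New annotations arise only at or below the position of a redex. *)
Lemma ann_back q k n : (k <= n)%N ->
  (forall j, (k <= j)%N -> (j < n)%N -> ~~ prefix (pi j) q) ->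
  ann (t n) q -> ann (t k) q.
Proof.
elim: n => [|n IH]; first by rewrite leqn0 => /eqP ->.
rewrite leq_eqVlt => /orP[/eqP ->//|kn] nopre; rewrite ann_succ.
rewrite (negbTE (nopre n kn (ltnSn n))) => /andP[an _]; apply: IH => // j kj jn.
by apply: nopre => //; exact: ltnW.
Qed.

(** The creator is the last step at or above the consumed position. Annotations consumed without a
    creator since [K] were present in [t K], at pairwise distinct positions, so there are finitely
    many of them. *)
Lemma creator_exists K : exists K', forall n, (K' <= n)%N -> isP n ->
  exists m, [/\ (K <= m)%N, (m < n)%N, prefix (pi m) (pi n) &
    forall j, (m < j)%N -> (j < n)%N -> ~~ prefix (pi j) (pi n)].
Proof.
pose S n := [/\ isP n, (K <= n)%N &
  forall j, (K <= j)%N -> (j < n)%N -> ~~ prefix (pi j) (pi n)].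
have [B BP] : exists B, forall n, (B <= n)%N -> ~ S n.
  apply: (@bounded_of_injective _ S pi (positions (t K))).
    move=> n [Pn Kn nopre]; apply: mem_positions => tKn.
    have := ann_back Kn nopre Pn.
    by rewrite /ann /sym_at tKn.
  move=> n m [Pn Kn npn] [Pm Km npm] e.
  have [nm|mn|//] := ltngtP n m.
    by have := npm n Kn nm; rewrite e prefix_refl.
  by have := npn m Km mn; rewrite e prefix_refl.
exists (maxn B K) => n; rewrite geq_max => /andP[Bn Kn] Pn.
pose Z j := [&& (K <= j)%N, (j < n)%N & prefix (pi j) (pi n)].
have exZ : exists j, Z j.
  apply: contrapT => nZ; apply: (BP n Bn); split=> // j Kj jn.
  by apply/negP => pj; apply: nZ; exists j; apply/and3P.
have ubZ j : Z j -> (j <= n)%N by case/and3P => _ /ltnW.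
case: (ex_maxnP exZ ubZ) => m /and3P[Km mn pm] mmax.
exists m; split=> // j mj jn; apply/negP => pj.
have : (j <= m)%N by apply: mmax; apply/and3P; rewrite (leq_trans Km (ltnW mj)).
by rewrite leqNgt mj.
Qed.

(** Between creation and consumption each step takes place elsewhere, leaving the annotated subterm
    unchanged, or strictly below the annotation. In the latter case its flag is true, as the
    annotation survives, so it is an innermost step of [np P]. *)
Lemma creator_edge m n : (m < n)%N -> isP n -> prefix (pi m) (pi n) ->
  (forall j, (m < j)%N -> (j < n)%N -> ~~ prefix (pi j) (pi n)) ->
  [/\ isP m, ann (x m).2 (drop (size (pi m)) (pi n)) & dg_edge P (al m) (al n)].
Proof.
move=> mn Pn pmn nopre.
have annk k : (m < k)%N -> (k <= n)%N -> ann (t k) (pi n).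
  move=> mk kn; apply: ann_back kn _ Pn => j kj jn.
  by apply: nopre => //; exact: leq_trans kj.
have := annk m.+1 (ltnSn m) mn; rewrite ann_succ pmn => /andP[Pm xq].
split=> //; split; first exact: alP.
split; first exact: alP.
case/prefixP: pmn => q piE; rewrite piE drop_size_cat// in xq.
case xu: (subterm_at (x m).2 q) => [u|]; last by rewrite /ann /sym_at xu in xq.
have [f uf] : exists f, root_sym (flat u) = Some f.
  move: xq; rewrite /ann /sym_at xu /=; case: (u) => //= f g _.
  by exists (flat_sym f).
have reach k : (m < k)%N -> (k <= n)%N ->
    exists2 y, subterm_at (flat (t k)) (pi n) = Some y &
    clos_refl_trans _ (innermost_step (np P))
      (sharp (subst (sg m) (flat u))) (sharp y).
  elim: k => [//|k IH]; rewrite ltnS leq_eqVlt => /orP[/eqP <-|mk] kn.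
    exists (subst (sg m) (flat u)); last exact: rt_refl.
    rewrite t_next flat_next piE subterm_at_replace ?redex_subterm//.
    by apply: subterm_at_subst; rewrite subterm_at_flat xu.
  have [y yk ry] := IH mk (ltnW kn).
  have npk := nopre k mk kn.
  have := annk k.+1 (ltnW mk) kn; rewrite ann_succ (negbTE npk) => /andP[_].
  rewrite t_next flat_next; case: (boolP (prefix (pi n) (pi k))) => /= [pnk|pnk _].
    rewrite orbF => fk; case/prefixP: pnk => q' pik.
    rewrite pik subterm_at_replace_above yk /=.
    eexists; first by [].
    apply: rt_trans ry _; apply: rt_step.
    apply: (@sharp_step y q' (al k)) => //; last 2 first.
    - by have := redex_subterm k; rewrite pik subterm_at_cat yk.
    - exact: redex_anf.
    - by apply/eqP => q'0; move: npk; rewrite pik q'0 cats0 prefix_refl.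
    - exact: alP.
  by exists y => //; rewrite subterm_at_replace_parallel.
have [y] := reach n mn (leqnn n); rewrite redex_subterm => -[<-] ry.
exists (sg m), (sg n), (x m), (flat u); split=> //.
- by exists q, u; split=> //; apply/pos_annotP.
- have [d ld] := problem_def_root (alP n).
  by rewrite (asubst_sharp _ uf) (asubst_sharp _ ld).
- exact: redex_anf.
- exact: redex_anf.
Qed.

(** There are finitely many ADPs, and each one that is applied to annotated redexes only finitely
    often drops out after some index. *)
Lemma eventually_recurrent : exists K, forall n, (K <= n)%N -> isP n ->
  forall k, exists m, [/\ (k <= m)%N, isP m & al m = al n].
Proof.
have [L PL] : exists L : seq (adp R Sg V), P = [set` L].
  by apply/finite_seqP; case: hP.
suff [K KP] : exists K, forall a, a \in L ->
    ~ (forall k, exists m, [/\ (k <= m)%N, isP m & al m = a]) ->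
    forall n, (K <= n)%N -> isP n -> al n <> a.
  exists K => n Kn Pn; apply: contrapT => nrec.
  apply: (KP (al n) _ nrec n Kn Pn) => //.
  by have := alP n; rewrite PL.
elim: (L) => [|a s [K KP]]; first by exists 0%N.
have [rec|/existsNP[k kP]] :=
    pselect (forall k, exists m, [/\ (k <= m)%N, isP m & al m = a]).
  by exists K => b; rewrite inE => /orP[/eqP -> //|]; exact: KP.
exists (maxn K k) => b; rewrite inE => /orP[/eqP ->|bs] nrec n;
  rewrite geq_max => /andP[Kn kn] Pn; last exact: KP Kn Pn.
by move=> an; apply: kP; exists n.
Qed.

(* Among the ADPs used infinitely often, take one that is maximal for
   reachability in the dependency graph. From some point on, the annotations
   consumed by the ADPs of its SCC are created by that SCC. *)
Lemma eventually_in_scc : (forall n, exists2 m, (n <= m)%N & isP m) ->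
  exists K a, [/\ P a, SCC P (scc a) & forall s : nat -> aterm Sg V,
    s K = t K ->
    (forall n, (K <= n)%N -> s n.+1 = next (s n) (flag (al n)) (sg n) (pi n)
      (if `[< scc a (al n) >] then (x n).2 else emb (flat (x n).2))) ->
    forall n, exists2 m, (n <= m)%N & (K <= m)%N && ann (s m) (pi m)].
Proof.
move=> Pinf.
pose I a := forall k, exists m, [/\ (k <= m)%N, isP m & al m = a].
have [K1 K1P] := eventually_recurrent.
have [L PL] : exists L : seq (adp R Sg V), P = [set` L].
  by apply/finite_seqP; case: hP.
have IP b : I b -> P b by move=> /(_ 0%N)[m [_ _ <-]]; exact: alP.
have [n0 K1n0 Pn0] := Pinf K1.
have [a [Ia _ amax]] := @maximal_above _ (clos_refl_trans _ (dg_edge P)) I L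
  (rt_refl _ _) (fun a b c => rt_trans _ _ a b c) (al n0) (K1P n0 K1n0 Pn0).
have {}amax b : I b -> clos_refl_trans _ (dg_edge P) b a ->
    clos_refl_trans _ (dg_edge P) a b.
  by move=> Ib; apply: amax => //; have := IP _ Ib; rewrite PL.
have [K2 K2P] := creator_exists K1.
have rt_t b c d : clos_refl_trans _ (dg_edge P) b c ->
    clos_trans _ (dg_edge P) c d -> clos_trans _ (dg_edge P) b d.
  by move=> /clos_rt_rt1n_iff; elim=> // b' c' d' bc _ IH /IH; apply: t_trans;
     exact: t_step.
have t_rt b c : clos_trans _ (dg_edge P) b c -> clos_refl_trans _ (dg_edge P) b c.
  by elim=> [b' c' bc|b' c' d' _ bc _ cd]; [exact: rt_step|exact: rt_trans bc cd].
have t_rt_trans b c d : clos_trans _ (dg_edge P) b c ->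
    clos_refl_trans _ (dg_edge P) c d -> clos_trans _ (dg_edge P) b d.
  move=> bc /clos_rt_rtn1_iff; elim=> // c' d' cd _ bc'.
  by apply: t_trans bc' _; exact: t_step.
(* The creator of an annotation consumed by [a] has an edge to [a], and maximality leads back from
   [a] to the creator. *)
have aa : clos_trans _ (dg_edge P) a a.
  have [n [K2n Pn an]] := Ia K2.
  have [m [K1m mn pmn nopre]] := K2P n K2n Pn.
  have [Pm _ mnE] := creator_edge mn Pn pmn nopre.
  apply: (rt_t _ (al m)); last by rewrite -an; exact: t_step.
  apply: amax; first exact: K1P.
  by rewrite -an; exact: rt_step.
exists K2, a; split; [exact: IP|exact: SCC_scc|].
move=> s sK sn.
have flat_s n : (K2 <= n)%N -> flat (s n) = flat (t n).
  elim: n => [|n IH]; first by rewrite leqn0 => /eqP K20; rewrite -K20 sK.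
  rewrite leq_eqVlt => /orP[/eqP <-|K2n]; first by rewrite sK.
  rewrite sn// t_next !flat_next IH//.
  by case: ifP => // _; rewrite flat_emb.
have ann_s n q : (K2 <= n)%N -> ann (s n.+1) q =
  if prefix (pi n) q then ann (s n) (pi n) && ann
     (if `[< scc a (al n) >] then (x n).2 else emb (flat (x n).2))
     (drop (size (pi n)) q)
  else ann (s n) q && (flag (al n) || ~~ prefix q (pi n)).
  by move=> K2n; rewrite sn// ann_next// flat_s// redex_subterm.
(* Strong induction through creators. The creator comes no earlier than [K1], hence is recurrent,
   and maximality puts it in the same SCC. If it precedes [K2], the annotation is already in the
   common label at [K2]. *)
have key n : (K2 <= n)%N -> isP n -> scc a (al n) -> ann (s n) (pi n).
  elim/ltn_ind: n => n IH K2n Pn [an na].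
  have [m [K1m mn pmn nopre]] := K2P n K2n Pn.
  have [Pm xm mnE] := creator_edge mn Pn pmn nopre.
  have ma : clos_trans _ (dg_edge P) (al m) a by apply: t_trans na; exact: t_step.
  have sccm : scc a (al m).
    split=> //; apply: (t_rt_trans _ a) => //.
    exact: amax (K1P m K1m Pm) (t_rt _ _ ma).
  (* Both sequences have the same redexes and flags, so between [m] and [n] the sequence [s] erases
     the annotation only if [t] does. *)
  have forward j : (m < j)%N -> (K2 <= j)%N -> (j <= n)%N -> ann (s j) (pi n) ->
      ann (s n) (pi n).
    move=> mj K2j jn sj.
    suff H k : (j <= k)%N -> (k <= n)%N -> ann (s k) (pi n) by exact: H.
    elim: k => [|k IHk]; first by rewrite leqn0 => /eqP j0; rewrite -j0.
    rewrite leq_eqVlt => /orP[/eqP <- //|jk kn].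
    have mk : (m < k)%N := leq_trans mj jk.
    have nk := nopre k mk kn.
    rewrite ann_s ?(leq_trans K2j)// (negbTE nk) IHk// ?(ltnW kn)//=.
    have : ann (t k.+1) (pi n).
      apply: ann_back kn _ Pn => i ki; apply: nopre.
      by apply: leq_trans ki; exact: ltnW.
    by rewrite ann_succ (negbTE nk) => /andP[].
  have [K2m|mK2] := leqP K2 m.
    apply: (forward m.+1) => //; first exact: leqW.
    by rewrite ann_s// pmn IH//= asboolT.
  apply: (forward K2) => //; rewrite sK; apply: ann_back Pn => // j K2j.
  by apply: nopre; exact: leq_trans K2j.
move=> n; have [m [nm Pm am]] := Ia (maxn n K2).
move: nm; rewrite geq_max => /andP[nm K2m].
by exists m => //; rewrite K2m key// am.
Qed.

End DependencyGraphPaths.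

(** * Chain trees and the processor *)

Section Trees.
Context {R : realType} {Sg : signature} {V : Type} {N : choiceType}.
Implicit Types (P Q : set (adp R Sg V)) (T : labelled_tree R Sg V N).

Lemma leafE T v : leaf T v <-> tip (edge T) v.
Proof.
split=> [lv w vw|tv]; last by apply/seteqP; split=> // w /tv.
by have : children T v w by []; rewrite lv.
Qed.

Lemma leaf_probE T : leaf_prob T = leaf_sum (edge T) (prob T).
Proof.
rewrite /leaf_prob /leaf_sum; congr esum; apply/seteqP.
by split=> v /leafE.
Qed.

Lemma locally_chain_flow P T r :
  (forall a, P a -> multi_distribution (rhs a)) ->
  directed_tree (edge T) r -> prob T r = 1 ->
  (forall v, finite_set (children T v)) -> (forall v, 0 < prob T v) ->
  locally_chain P T -> flow_tree (edge T) r (prob T).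
Proof.
move=> md tr pr1 fin pos loc; split=> // v [w vw].
have [|m gm _] := locally_chain_move fin pos loc (v := v).
  by move=> /leafE /(_ w).
by apply: good_move_flow (gm) => //; apply: md; case: gm => -[].
Qed.

Definition has_moves P T (mv : N -> @move R Sg V N) : Prop :=
  forall v, ~ tip (edge T) v ->
    good_move P T v (mv v) /\ (nodesP T v <-> ann (label T v) (mv_pos (mv v))).

Lemma has_moves_chain P T mv :
  (forall v, finite_set (children T v)) -> (forall v, 0 < prob T v) ->
  (forall v, nodesP T v -> ~ tip (edge T) v) -> has_moves P T mv ->
  locally_chain P T.
Proof.
move=> fin pos inner hm; split=> [v vP|v vl vP].
  have [gm annE] := hm v (inner v vP).
  by have := good_move_step (fin v) (pos v) gm; rewrite (iffLR annE vP).
have [|gm annE] := hm v; first by move=> /leafE.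
have := good_move_step (fin v) (pos v) gm.
by case: ifP => // /annE.
Qed.

End Trees.

(** * Pruning labelled trees *)

Section RestrictedTree.
Context {R : realType} {Sg : signature} {V : Type} {N : choiceType}.
Implicit Types (P Q : set (adp R Sg V)) (T : labelled_tree R Sg V N).

Definition restrict_tree T (u : N) (cut : N -> Prop) :
    labelled_tree R Sg V (rnode (edge T) u cut) :=
  LabelledTree (@rE _ (edge T) u cut) (rp (prob T) (u := u) (cut := cut))
    (fun a => label T (sval a))
    [set a | nodesP T (sval a) /\ ~ cut (sval a)].

Definition restrict_move (E : N -> N -> Prop) (u : N) (cut : N -> Prop)
    (m : @move R Sg V N) : @move R Sg V (rnode E u cut) :=
  Move (mv_adp m) (mv_sub m) (mv_pos m) (fun b => mv_pick m (sval b)).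

Lemma good_move_restrict P T r u cut (a : rnode (edge T) u cut) m :
  flow_tree (edge T) r (prob T) -> ~ cut (sval a) ->
  good_move P T (sval a) m ->
  good_move P (restrict_tree T u cut) a (restrict_move (edge T) u cut m).
Proof.
move=> ft nc [red perm pE lE]; split=> //.
- have := perm_map (mv_pick m) (perm_rchildren ft nc).
  rewrite -map_comp => /permPl; rewrite /children /= => ->; exact: perm.
- by move=> b [ab _]; rewrite /= /rp pE// mulrAC.
- by move=> b [ab _]; exact: lE.
Qed.

(** Moves are required only below [u], since recomputed labels are meaningful only there. *)
Lemma restrict_has_moves P T r u cut mv : flow_tree (edge T) r (prob T) ->
  (forall v, below (edge T) u cut v -> ~ tip (edge T) v ->
    good_move P T v (mv v) /\ (nodesP T v <-> ann (label T v) (mv_pos (mv v)))) ->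
  has_moves P (restrict_tree T u cut)
    (fun a => restrict_move (edge T) u cut (mv (sval a))).
Proof.
move=> ft hm a ta.
have nc : ~ cut (sval a) by move=> ca; apply: ta; apply/rtip; right.
have nt : ~ tip (edge T) (sval a) by move=> t; apply: ta; apply/rtip; left.
have [gm annE] := hm _ (belowP a) nt.
split; first exact: good_move_restrict ft nc gm.
by split=> [[/annE]//|/annE].
Qed.

(** [T] may violate the condition on infinite paths. The prunings considered by [pr_count_small]
    satisfy it, so they are chain trees and [iAST P] applies to them. *)
Lemma iAST_pr_count P T r mv : iAST P -> flow_tree (edge T) r (prob T) ->
  (forall v, nodesP T v -> ~ tip (edge T) v) -> has_moves P T mv ->
  forall eps, 0 < eps -> exists k, forall n,
    pr (edge T) r (prob T) n
      (fun v => (k <= count (edge T) r (nodesP T) v)%N) <= eps.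
Proof.
move=> ast ft inner hm; apply: pr_count_small => // cut inf.
have rft := rflow r cut ft.
rewrite -(leaf_probE (restrict_tree T r cut)); apply: ast; split.
  by exists (rroot _ _ _); [exact: ft_tree rft|exact: ft_root rft].
have rin a : nodesP (restrict_tree T r cut) a ->
    ~ tip (edge (restrict_tree T r cut)) a.
  by move=> [/inner nt nc] /rtip[].
split.
- exact: ft_fin rft.
- move=> a; rewrite (ft_pos rft) /=.
  exact: (p_le1 rft).
- by move=> a /rin nt /leafE.
- apply: has_moves_chain (restrict_has_moves ft (fun v _ => hm v)) => //.
    exact: ft_fin rft.
  exact: ft_pos rft.
- move=> w wE n; have [m nm Dm] := inf (fun n => sval (w n)) wE n.
  by exists m => //; split=> //; case: (wE m).
Qed.

End RestrictedTree.

(** * The processed problem *)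

Section Processor.
Context {R : realType} {Sg : signature} {V : Type}.
Implicit Types (P Q : set (adp R Sg V)) (a b : adp R Sg V).

Definition flat_outside P Q : set (adp R Sg V) :=
  Q `|` (@flat_adp R Sg V) @` (P `\` Q).

Lemma lhs_flat_outside P Q : Q `<=` P ->
  @lhs R Sg V @` flat_outside P Q = @lhs R Sg V @` P.
Proof.
move=> QP; apply/seteqP; split=> [_ [a [Qa|[b [Pb _] <-]] <-]|_ [a Pa <-]].
- by exists a => //; exact: QP.
- by exists b.
- have [Qa|nQa] := pselect (Q a); first by exists a => //; left.
  by exists (flat_adp a) => //; right; exists a.
Qed.

Lemma ANF_flat_outside P Q : Q `<=` P ->
  ANF (flat_outside P Q) = ANF P :> set (aterm Sg V).
Proof. by move=> QP; rewrite /ANF /adp_nf lhs_flat_outside. Qed.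

Lemma chain_treeP (N : choiceType) P (T : labelled_tree R Sg V N) :
  (forall a, P a -> multi_distribution (rhs a)) ->
  chain_tree P T -> exists r mv,
  [/\ flow_tree (edge T) r (prob T), has_moves P T mv &
    forall w : nat -> N, (forall n, edge T (w n) (w n.+1)) ->
      forall n, exists2 m, (n <= m)%N & nodesP T (w m)].
Proof.
move=> md [[r tr pr1] [fin pos _ loc inf]].
have pos' v : 0 < prob T v by case/andP: (pos v).
have /choice[mv mvP] : forall v, exists m : @move R Sg V N, ~ tip (edge T) v ->
    good_move P T v m /\ (nodesP T v <-> ann (label T v) (mv_pos m)).
  move=> v; have [tv|ntv] := pselect (tip (edge T) v).
    (* A dummy value, as leaves make no move. *)
    by exists (Move (ADP (flat (label T v)) (seq_mset [::]) true) Var [::]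
      (fun=> (0, label T v))).
  have [|m gm annE] := locally_chain_move fin pos' loc (v := v).
    by move=> /leafE.
  by exists m.
by exists r, mv; split=> //; exact: locally_chain_flow md tr pr1 fin pos' loc.
Qed.

Lemma multi_distribution_flat a :
  multi_distribution (rhs a) -> multi_distribution (rhs (flat_adp a)).
Proof.
move=> [rng sum1]; split=> [x|].
  by rewrite (perm_mem (perm_eq_seq_mset _)) => /mapP[y /rng ? ->].
by rewrite (perm_big _ (perm_eq_seq_mset _)) /= big_map sum1.
Qed.

Lemma multi_distribution_flat_outside P Q : adp_problem P -> Q `<=` P ->
  forall a, flat_outside P Q a -> multi_distribution (rhs a).
Proof.
move=> hP QP a [/QP/hP.2[]//|[b [Pb _] <-]].
by apply: multi_distribution_flat; case: (hP.2 _ Pb).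
Qed.

(** Elements of a right-hand side may coincide after flattening, so the originals are assigned to
    the children by matching multisets. *)
Lemma unflatten_move (N : choiceType) P Q (T : labelled_tree R Sg V N) v m :
  Q `<=` P -> finite_set (children T v) -> good_move (flat_outside P Q) T v m ->
  exists m' : @move R Sg V N,
    [/\ P (mv_adp m'), lhs (mv_adp m') = lhs (mv_adp m),
        flag (mv_adp m') = flag (mv_adp m) &
    [/\ mv_sub m' = mv_sub m, mv_pos m' = mv_pos m,
        perm_eq [seq mv_pick m' w | w <- fset_set (children T v)]
          (rhs (mv_adp m'))
      & forall w, edge T v w -> [/\ (mv_pick m' w).1 = (mv_pick m w).1,
         flat (mv_pick m' w).2 = flat (mv_pick m w).2 &
         forall q, ann (mv_pick m w).2 q -> ann (mv_pick m' w).2 q]]].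
Proof.
move=> QP fin gm; have [[Qm _ _ _] perm _ _] := gm.
case: Qm => [Qm|[b [Pb _] bm]].
  by exists m; do 2?split=> //; exact: QP.
move: perm; rewrite -bm (permPr (perm_eq_seq_mset _)).
move=> /(perm_map_match (0, label T v) (fset_uniq _))[f perm fE].
exists (Move b (mv_sub m) (mv_pos m) f); do 2?split=> //.
move=> w vw; have -> /= : mv_pick m w = ((f w).1, emb (flat (f w).2)).
  by apply: fE; rewrite in_fset_set// inE.
by split=> //; [rewrite flat_emb|move=> q; rewrite ann_emb].
Qed.

(* A chain tree of the processed problem becomes one of [P] by restoring the
   erased annotations: redexes only gain annotations. *)
Lemma iAST_flat_outside P Q : adp_problem P -> Q `<=` P ->
  iAST P -> iAST (flat_outside P Q).
Proof.
move=> hP QP ast N T ct.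
have [r [mv [ft hm inf]]] :=
  chain_treeP (multi_distribution_flat_outside hP QP) ct.
have tree := ft_tree ft.
have /choice[mv' mv'P] : forall v, exists m' : @move R Sg V N,
    ~ tip (edge T) v ->
    [/\ P (mv_adp m'), lhs (mv_adp m') = lhs (mv_adp (mv v)),
        flag (mv_adp m') = flag (mv_adp (mv v)) &
    [/\ mv_sub m' = mv_sub (mv v), mv_pos m' = mv_pos (mv v),
        perm_eq [seq mv_pick m' w | w <- fset_set (children T v)]
          (rhs (mv_adp m'))
      & forall w, edge T v w -> [/\ (mv_pick m' w).1 = (mv_pick (mv v) w).1,
         flat (mv_pick m' w).2 = flat (mv_pick (mv v) w).2 &
         forall q, ann (mv_pick (mv v) w).2 q -> ann (mv_pick m' w).2 q]]].
  move=> v; have [tv|ntv] := pselect (tip (edge T) v); first by exists (mv v).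
  by have [m' m'P] := unflatten_move QP (ft_fin ft v) (hm v ntv).1; exists m'.
pose s := treefun (edge T) r (label T r) (fun v w t => succ_label (mv' v) t w).
have droot b : flat_outside P Q b -> def_root b.
  by move=> [/QP/hP.2[]//|[c [/hP.2[rc _ _] _] <-]].
have redexT v : ~ tip (edge T) v ->
    subterm_at (flat (label T v)) (mv_pos (mv v)) =
      Some (subst (mv_sub (mv v)) (lhs (mv_adp (mv v)))) /\
    ANF P (emb (subst (mv_sub (mv v)) (lhs (mv_adp (mv v))))).
  move=> /hm[[red _ _ _] _]; have Qv : flat_outside P Q (mv_adp (mv v)).
    by case: red.
  by have /(redexE _ _ _ Qv (droot _ Qv)) := red; rewrite ANF_flat_outside.
have sP v : flat (s v) = flat (label T v) /\
    forall q, ann (label T v) q -> ann (s v) q.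
  move: v; apply: (tree_induction tree) => [|v w vw [fs as_]].
    by rewrite /s (treefun_root tree).
  have ntv : ~ tip (edge T) v by move=> /(_ w).
  have [_ _ flE [subE posE _ /(_ w vw)[_ fE aE]]] := mv'P v ntv.
  have [[_ _ _ lE] _] := hm v ntv; have [sub _] := redexT v ntv.
  rewrite /s (treefun_edge tree _ _ vw) -/s lE// /succ_label flE subE posE.
  rewrite !flat_next fs fE; split=> // q.
  rewrite !ann_next ?fs ?sub//; case: ifP => _ /andP[h1 h2]; apply/andP; split=> //.
  - exact: as_.
  - exact: aE.
  - exact: as_.
(* The annotated nodes are determined anew. They include the former ones, which preserves the
   condition on infinite paths. *)
pose T' := LabelledTree (edge T) (prob T) s
  [set v | ~ tip (edge T) v /\ ann (s v) (mv_pos (mv' v))].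
rewrite leaf_probE -(leaf_probE T'); apply: ast.
case: ct => -[r' tr' pr'] [fin pos _ _ _].
have hm' : has_moves P T' mv'.
  move=> v ntv; split; last by split=> [[]|].
  have [Pv lhsE flE [subE posE perm pickE]] := mv'P v ntv.
  have [[_ _ pE _] _] := hm v ntv; have [sub anf] := redexT v ntv.
  split=> //.
  - apply/redexE => //; first by case: (hP.2 _ Pv).
    by rewrite (sP v).1 lhsE subE posE.
  - by move=> w vw; rewrite /= pE//; have [-> _ _] := pickE w vw.
  - by move=> w vw; rewrite /= /s (treefun_edge tree _ _ vw).
split; first by exists r'.
split=> //.
- by move=> v [ntv _] /leafE.
- apply: has_moves_chain hm' => //; first by move=> v; case/andP: (pos v).
  by move=> v [].
move=> w wE n; have [m nm mP] := inf w wE n; exists m => //.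
have ntm : ~ tip (edge T) (w m) by move=> /(_ _ (wE m)).
split=> //; apply: (sP _).2.
have [_ _ _ [_ -> _ _]] := mv'P _ ntm.
by apply/(hm _ ntm).2.
Qed.

(** * Soundness: following one set of ADPs from one node *)

Section Soundness.
Variables (P Q : set (adp R Sg V)) (N : choiceType).
Variables (T : labelled_tree R Sg V N) (r : N) (mv : N -> @move R Sg V N).
Variable (u : N).
Hypotheses (hP : adp_problem P) (QP : Q `<=` P).
Hypotheses (ft : flow_tree (edge T) r (prob T)) (hm : has_moves P T mv).
Let tree : directed_tree (edge T) r := ft_tree ft.
Local Notation al v := (mv_adp (mv v)).

Definition track_rhs a (t : aterm Sg V) : aterm Sg V :=
  if `[< Q a >] then t else emb (flat t).

(* The labels of [T] recomputed from [u] downwards, with the ADPs outside [Q]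
   flattened; the values at nodes not below [u] are irrelevant. *)
Definition track : N -> aterm Sg V :=
  treefun (edge T) r (label T r) (fun v w s => if w == u then label T u else
    next s (flag (al v)) (mv_sub (mv v)) (mv_pos (mv v))
      (track_rhs (al v) (mv_pick (mv v) w).2)).

Definition track_move v : @move R Sg V N :=
  Move (if `[< Q (al v) >] then al v else flat_adp (al v))
    (mv_sub (mv v)) (mv_pos (mv v))
    (fun w => ((mv_pick (mv v) w).1, track_rhs (al v) (mv_pick (mv v) w).2)).

(** In general not a chain tree, even below [u]: an infinite path may have only finitely many
    annotated redexes left. *)
Definition track_tree : labelled_tree R Sg V N :=
  LabelledTree (edge T) (prob T) track
    [set v | ~ tip (edge T) v /\ ann (track v) (mv_pos (mv v))].

Lemma track_start : track u = label T u.
Proof.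
rewrite /track; case e: (depth (edge T) r u) => [|n].
  by rewrite (depth0 tree e) (treefun_root tree).
by have [v vu _] := depthS tree e; rewrite (treefun_edge tree _ _ vu) eqxx.
Qed.

Lemma track_edge v w : (depth (edge T) r u <= depth (edge T) r v)%N ->
  edge T v w -> track w = next (track v) (flag (al v)) (mv_sub (mv v))
    (mv_pos (mv v)) (track_rhs (al v) (mv_pick (mv v) w).2).
Proof.
move=> uv vw; rewrite /track (treefun_edge tree _ _ vw); case: eqP => // wu.
by move: uv; rewrite -wu (depth_edge tree vw) ltnn.
Qed.

Lemma flat_track v : flat (track v) = flat (label T v).
Proof.
move: v; apply: (tree_induction tree) => [|v w vw IH].
  by rewrite /track (treefun_root tree).
rewrite /track (treefun_edge tree _ _ vw) -/track; case: eqP => [->//|_].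
have ntv : ~ tip (edge T) v by move=> /(_ w).
have [[_ _ _ lE] _] := hm ntv; rewrite lE// /succ_label !flat_next IH.
by rewrite /track_rhs; case: ifP => // _; rewrite flat_emb.
Qed.

Lemma track_good_move v : (depth (edge T) r u <= depth (edge T) r v)%N ->
  ~ tip (edge T) v -> good_move (flat_outside P Q) track_tree v (track_move v).
Proof.
move=> uv ntv; have [[red perm pE lE] _] := hm ntv.
have Pv : P (al v) by case: red.
have dv : def_root (al v) by case: (hP.2 _ Pv).
have [sub anf] := iffLR (redexE _ _ _ Pv dv) red.
split.
- apply/redexE => /=.
  + by case: asboolP => Qv; [left|right; exists (al v)].
  + by case: asboolP => Qv.
  rewrite flat_track ANF_flat_outside//.
  by case: asboolP => Qv.
- rewrite /= /track_rhs; case: asboolP => Qv.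
    rewrite (eq_map (g := mv_pick (mv v))) // => w.
    by case: (mv_pick _ _).
  rewrite (permPr (perm_eq_seq_mset _)).
  have := perm_map (fun x => (x.1, emb (flat x.2))) perm.
  by rewrite -map_comp.
- by move=> w vw; rewrite /= pE.
- move=> w vw; rewrite /= (track_edge uv vw) /succ_label /=; congr next.
  by case: asboolP.
Qed.

Definition track_paths : set (nat -> N) := [set w |
  (forall n, edge T (w n) (w n.+1)) /\ exists2 K, w K = u &
  forall n, exists2 m, (n <= m)%N &
    (K <= m)%N && ann (track (w m)) (mv_pos (mv (w m)))].

(** The cover consists of the nodes reached after at least [k] annotated redexes since [u]; paths in
    [track_paths] exceed every such [k]. *)
Lemma null_track_paths : iAST (flat_outside P Q) ->
  null (edge T) r (prob T) track_paths.
Proof.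
move=> ast eps eps0.
(* Here the tree is only restarted at [u]; the actual cuts are made within [iAST_pr_count]. *)
pose nocut (v : N) := False.
pose Tu := restrict_tree track_tree u nocut.
have rft : flow_tree (edge Tu) (rroot (edge T) u nocut) (prob Tu).
  exact: (@rflow _ _ (edge T) r (prob T) u nocut ft).
have hmu : has_moves (flat_outside P Q) Tu
    (fun x => restrict_move (edge T) u nocut (track_move (sval x))).
  apply: (restrict_has_moves (T := track_tree)) ft _ => v bv ntv.
  split; first exact: track_good_move (below_depth ft bv) ntv.
  by split=> [[]|].
have inner x : nodesP Tu x -> ~ tip (edge Tu) x.
  by move=> [[nt _] _] /rtip[].
have [k kP] := iAST_pr_count ast rft inner hmu eps0.
pose G v := exists2 b : rnode (edge T) u nocut, sval b = v &
  (k <= count (edge Tu) (rroot (edge T) u nocut) (nodesP Tu) b)%N.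
have hG : heredit (edge T) G.
  move=> v w vw [b bv kb].
  have red : redge (edge T) nocut v w by split.
  have bw : below (edge T) u nocut w.
    by apply: below_redge red; rewrite -bv; exact: belowP.
  exists (rnode_of bw) => //; apply: (heredit_count rft) kb.
  by rewrite /= /rE /= bv.
exists G; split=> // [n|w [wE [K wK inf]]].
  (* Moving to depth [n] below [u] can only increase the mass of the hereditary set [G]. *)
  apply: le_trans (pr_heredit ft hG (leq_addl (depth (edge T) r u) n)) _.
  apply: le_trans (_ : pr (edge T) r (prob T) (depth (edge T) r u + n)
    (fun v => below (edge T) u nocut v /\ G v) <= _).
    apply: (pr_sub ft) => v _ [b bv kb]; split; last by exists b.
    by rewrite -bv; exact: belowP.
  apply: le_trans (pr_restrict u nocut ft n G) _.
  apply: le_trans (_ : 1 * pr (edge Tu) (rroot (edge T) u nocut) (prob Tu) n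
    (fun x => G (sval x)) <= _).
    by apply: ler_wpM2r; [exact: (pr_ge0 rft)|exact: (p_le1 ft)].
  rewrite mul1r; apply: le_trans (kP n); apply: (pr_sub rft) => x _ [y e].
  by rewrite (sval_inj e).
have bl j : below (edge T) u nocut (w (K + j)%N).
  elim: j => [|j IH]; first by rewrite addn0 wK; exact: rt_refl.
  by apply: below_redge IH _; rewrite addnS; split=> //; exact: wE.
have [||n kn] := path_count_unbounded (D := nodesP Tu) rft
    (w := fun j => rnode_of (bl j)) _ _ k.
- by move=> j; rewrite /= /rE /= addnS; split=> //; exact: wE.
- move=> n; have [m nm /andP[Km annm]] := inf (K + n)%N.
  exists (m - K)%N; first by rewrite leq_subRL.
  split; last by [].
  split=> /=; last by rewrite subnKC.
  by move=> /(_ _ (wE _)).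
- by exists (K + n)%N; exists (rnode_of (bl n)).
Qed.

End Soundness.

Lemma iAST_of_SCC P : adp_problem P ->
  (forall Q, SCC P Q -> iAST (flat_outside P Q)) -> iAST P.
Proof.
move=> hP astQ N T ct.
have [|r [mv [ft hm inf]]] := chain_treeP _ ct.
  by move=> a /hP.2[].
have [L PL] : exists L : seq (adp R Sg V), P = [set` L].
  by apply/finite_seqP; case: hP.
rewrite leaf_probE; apply: (null_leaf_sum1 ft).
pose A (u : N) a := [set w | SCC P (scc P a) /\ track_paths (scc P a) T r mv u w].
have nA u a : null (edge T) r (prob T) (A u a).
  have [S|nS] := pselect (SCC P (scc P a)); last first.
    by apply: sub_null (null_set0 _ _ _) => w [/nS].
  apply: sub_null (null_track_paths (P := P) u hP _ ft hm (astQ _ S)).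
    by move=> w [].
  by case: S.
(* The starting nodes [u] are enumerated depth by depth: a countable union over [K] of finite unions
   over the frontier and over the ADPs. *)
apply: sub_null (null_bigcup ft (fun K => null_bigcup_seq ft
  (frontier (edge T) r K) (fun u => null_bigcup_seq ft L (nA u)))).
move=> w [w0 wE].
have ntw n : ~ tip (edge T) (w n) by move=> /(_ _ (wE n)).
have dw n : depth (edge T) r (w n) = n.
  by rewrite (path_depth (ft_tree ft) wE) w0 (depth_root (ft_tree ft)).
have [] := @eventually_in_scc _ _ _ P hP (fun n => label T (w n))
  (fun n => mv_adp (mv (w n))) (fun n => mv_sub (mv (w n)))
  (fun n => mv_pos (mv (w n))) (fun n => mv_pick (mv (w n)) (w n.+1)).
- by move=> n; have [[]] := hm _ (ntw n).
- move=> n; have [[_ perm _ _] _] := hm _ (ntw n).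
  rewrite -(perm_mem perm); apply: map_f.
  by rewrite in_fset_set; [rewrite inE; exact: wE|exact: (ft_fin ft)].
- by move=> n; have [[_ _ _ lE] _] := hm _ (ntw n); exact: lE.
- move=> n; have [m nm mP] := inf w wE n; exists m => //.
  by apply/(hm _ (ntw m)).2.
move=> K [a [Pa sccP trackP]].
exists K => //; exists (w K); first by apply/(mem_frontier ft); left.
exists a; first by move: Pa; rewrite PL.
split=> //; split=> //; exists K => //.
apply: (trackP (fun n => track (scc P a) T r mv (w K) (w n))).
  exact: track_start ft.
by move=> n Kn; apply: (track_edge _ _ ft); [rewrite !dw|exact: wE].
Qed.

End Processor.

Theorem theorem14 (R : realType) (Sg : signature) (V : Type)
    (P : set (adp R Sg V)) (hP : adp_problem P) :
  iAST P <->
  forall Q : set (adp R Sg V), SCC P Q ->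
    iAST (Q `|` (@flat_adp R Sg V) @` (P `\` Q)).
Proof.
split=> [ast Q [_ QP _ _]|]; first exact: iAST_flat_outside.
exact: iAST_of_SCC.
Qed.
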